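(* Let $k\ge 2$, let $f_1,\dots,f_{k-1}$ be smooth nowhere vanishing functions on an open interval $I\ni x_0$, and let $P(u)=\sum_{i=0}^{N}c_iu^i\in\mathbb{C}[u]$ with $c_N\ne0$, $N>1$. Let $j_1,\dots,j_{k''}\in\{1,\dots,k-1\}$ be distinct indices, $k''\le k-1$. Assume that for each $s$ the function $V_{j_s}$ satisfies the Liouville criterion and/or the integration-by-parts criterion (defined in the context), and that the equation $P(u)-d=0$ (with $d$ a complex parameter) is solvable by radicals. Then, for all constants $A_{j_s}\in\mathbb{C}$, the functions $$u(x,t)=\alpha_{k'}\Big((c_i)_{i=0}^{N},\ \sum_{s=1}^{k''}A_{j_s}V_{j_s}(x,t)\Big)$$ are solutions, elementary with respect to $x$, of $$\partial_x f_{k-1}\partial_x f_{k-2}\partial_x\cdots\partial_x f_2\partial_x f_1\partial_x P(u)=0 .$$ In particular, if $V_1(x,t)=f(t)\int_{x_0}^x\frac{ds}{f_1(s)}$ is elementary with respect to $x$ for a suitable $f(t)$ and $P(u)-d=0$ is solvable by radicals, then $u(x,t)=\alpha_{k'}\big((c_i)_{i=0}^{N},V_1(x,t)\big)$ are elementary solutions of this equation.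
   Context: $f(t)$ is a given function of the parameter $t$. Put $R_{f_j}(x)=\int_{x_0}^x\frac{ds}{f_j(s)}$, $g_{j:j}=R_{f_j}$, $g_{i:j}(x)=\int_{x_0}^x\frac{g_{i+1:j}(s)}{f_i(s)}ds$ for $2\le i\le j-1$; $V_1(x,t)=f(t)R_{f_1}(x)$ and $V_j(x,t)=f(t)\int_{x_0}^x\frac{g_{2:j}(s)}{f_1(s)}ds$ for $2\le j\le k-1$. These are solutions of the linear equation $\partial_x f_{k-1}\partial_x\cdots\partial_x f_1\partial_xV=0$. Write $g_{2:1}:=1$. $V_j$ satisfies the Liouville criterion if $\frac{g_{2:j}(x)}{f_1(x)}=\sum_{i=1}^n c_i'\frac{h_i'(x)}{h_i(x)}+\sigma'(x)$ on $I$ for some constants $c_i'\in\mathbb{C}$ and elementary functions $h_i$ (nowhere zero on $I$) and $\sigma$. $V_j$ satisfies the integration-by-parts criterion if there exist elementary functions $\nu,S$ and a positive integer $p$ with $\nu^{(p+1)}=\frac1{f_1}$ and $S'=g_{2:j}^{(p+1)}\nu$. The functions $\alpha_{k'}((c_i)_{i=0}^{N},d)$ are the roots $u$ of $P(u)-d=0$ as functions of $d$, i.e. holomorphic branches on open sets $\Omega\subset\mathbb{C}$ with $P(\alpha_{k'}((c_i),d))=d$ for $d\in\Omega$. The functions $u(x,t)$ are considered, for each fixed $t$, on open subintervals of $I$ on which the second argument of $\alpha_{k'}$ takes values in $\Omega$. Elementary functions: one considers differential fields whose elements are complex-valued functions of the real variable $x$ on a suitable open interval with derivation $d/dx$, starting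 from $\mathbb{C}(x)$ (all fields can be taken inside the field of quotients of complex-valued real-analytic functions on the interval; functions occurring in the statement are assumed defined and smooth there). A simple extension $K\subset K(g)$ is called elementary if it is exponential ($g'=s'g$, $s\in K$), or logarithmic ($g'=s'/s$, $0\ne s\in K$), or algebraic ($g$ is a root of an irreducible polynomial over $K$). A function is elementary if it belongs to the last field of a finite chain $\mathbb{C}(x)\subset K_1\subset\dots\subset K_r$ of elementary extensions. A function of $(x,t)$ is elementary with respect to $x$ if it is an elementary function of $x$ for each fixed $t$.
   Formalization: Where V_j is admitted through the integration-by-parts criterion alone, g_{2:j} is additionally assumed to be an elementary function on I; without this the claim fails (e.g. f_1=1, 1/f_2 = 5+∫2e^s/s² ds, ν=x²/2, p=1, S=e^x). *)

(* Defs.v *)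
From Stdlib Require Import Reals.
From Coquelicot Require Import Coquelicot.
From mathcomp Require Import all_boot all_algebra all_field.
From mathcomp Require Import complex Rstruct.

Set Implicit Arguments.
Unset Strict Implicit.
Unset Printing Implicit Defensive.

Import GRing.Theory.

(* Analysis uses Coquelicot's complex numbers [C = R * R]; only the algebraic
   notion "solvable by radicals" uses MathComp, with [R[i]] over the same [R]. *)

(** * Solvability by radicals *)

Section SolvableByRadicals.
Local Open Scope ring_scope.

(* All roots of [p] lie in an extension of [F] obtained by successively
   adjoining radicals. *)
Definition solvable_by_radicals (F : fieldType) (p : {poly F}) : Prop :=
  exists (L : fieldExtType F) (e roots : seq L),
    [/\ forall i, (i < size e)%N ->
          exists2 n, (0 < n)%N & e`_i ^+ n \in <<1%VS & take i e>>%VS,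
        map_poly (in_alg L) p %= \prod_(z <- roots) ('X - z%:P)
      & {subset roots <= <<1%VS & e>>%VS}].

Definition Ri_of_C (z : C) : R[i] := Complex z.1 z.2.

(* [P(u) - d] as a polynomial in [u] over the rational function field [C(d)]. *)
Definition P_minus_d (N : nat) (c : nat -> C) :
    {poly {fraction {poly R[i]}}} :=
  \poly_(i < N.+1) (tofrac (Ri_of_C (c i))%:P) - (tofrac 'X)%:P.

End SolvableByRadicals.

(** * Functions of a real variable with values in [C] *)

Local Open Scope C_scope.

Definition ointerval (a b : Rbar) (x : R) : Prop :=
  Rbar_lt a x /\ Rbar_lt x b.

(* [Dx f x] is the derivative only where [f] is differentiable. *)
Definition Dx (f : R -> C) (x : R) : C :=
  (Derive (fun y => fst (f y)) x, Derive (fun y => snd (f y)) x).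

Definition Dn (n : nat) (f : R -> C) : R -> C := iter n Dx f.

Definition smooth_on (J : R -> Prop) (f : R -> C) : Prop :=
  forall n x, J x -> ex_derive (V := C_R_NormedModule) (Dn n f) x.

Definition analytic_on (J : R -> Prop) (f : R -> C) : Prop :=
  forall x, J x -> exists a : nat -> C,
    locally x (fun y => is_pseries (V := C_R_NormedModule) a (Rminus y x) (f y)).

Definition CInt (f : R -> C) (x0 x : R) : C :=
  RInt (V := C_R_CompleteNormedModule) f x0 x.

Definition Peval (N : nat) (c : nat -> C) (u : C) : C :=
  sum_n (fun i => c i * Cpow u i) N.

(** * Elementary functions *)

(* The quotient field of the ring of analytic functions on an open interval
   [J].  An element is represented by any function [R -> C] which agrees with
   a quotient [a / b] wherever [b] does not vanish; two representatives denote
   the same element when [same J] holds.  The values of a representative at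
   the zeros of the denominators are irrelevant. *)
Definition nonzero_on (J : R -> Prop) (b : R -> C) : Prop :=
  exists2 x, J x & b x <> 0.

Definition quotient_of_analytic (J : R -> Prop) (F : R -> C) : Prop :=
  exists a b, [/\ analytic_on J a, analytic_on J b, nonzero_on J b
    & forall x, J x -> b x <> 0 -> F x = a x / b x].

Definition same (J : R -> Prop) (F G : R -> C) : Prop :=
  exists b, [/\ analytic_on J b, nonzero_on J b
    & forall x, J x -> b x <> 0 -> F x = G x].

Definition zero_fun : R -> C := fun _ => 0.

(* [adjoin J K g] is the field K(g), as a set of representatives. *)
Inductive adjoin (J : R -> Prop) (K : (R -> C) -> Prop) (g : R -> C) :
    (R -> C) -> Prop :=
| adjoin_base h : K h -> adjoin J K g h
| adjoin_gen : adjoin J K g g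
| adjoin_add h1 h2 : adjoin J K g h1 -> adjoin J K g h2 ->
    adjoin J K g (fun x => h1 x + h2 x)
| adjoin_opp h : adjoin J K g h -> adjoin J K g (fun x => - h x)
| adjoin_mul h1 h2 : adjoin J K g h1 -> adjoin J K g h2 ->
    adjoin J K g (fun x => h1 x * h2 x)
| adjoin_inv h : adjoin J K g h -> ~ same J h zero_fun ->
    adjoin J K g (fun x => / h x)
| adjoin_same h1 h2 : adjoin J K g h1 -> same J h1 h2 -> adjoin J K g h2.

Definition constants (J : R -> Prop) (h : R -> C) : Prop :=
  exists c : C, same J h (fun _ => c).

Definition rational_functions (J : R -> Prop) : (R -> C) -> Prop :=
  adjoin J (constants J) RtoC.

(* Polynomials over [K] in one indeterminate, as coefficient sequences. *)
Definition poly_of_degree (J : R -> Prop) (K : (R -> C) -> Prop) (n : nat)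
    (a : nat -> R -> C) : Prop :=
  [/\ forall i, K (a i), ~ same J (a n) zero_fun
    & forall i, (n < i)%N -> same J (a i) zero_fun].

Definition irreducible (J : R -> Prop) (K : (R -> C) -> Prop) (n : nat)
    (a : nat -> R -> C) : Prop :=
  [/\ (0 < n)%N, poly_of_degree J K n a
    & forall m l b c, poly_of_degree J K m b -> poly_of_degree J K l c ->
        (forall i, same J (a i)
           (fun x => sum_n (fun q => b q x * c (i - q)%N x) i)) ->
        m = 0%N \/ l = 0%N].

Definition exponential_over (J : R -> Prop) (K : (R -> C) -> Prop)
    (g : R -> C) : Prop :=
  exists2 s, K s & same J (Dx g) (fun x => Dx s x * g x).

Definition logarithmic_over (J : R -> Prop) (K : (R -> C) -> Prop)
    (g : R -> C) : Prop :=
  exists s, [/\ K s, ~ same J s zero_fun & same J (Dx g) (fun x => Dx s x / s x)].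

Definition algebraic_over (J : R -> Prop) (K : (R -> C) -> Prop)
    (g : R -> C) : Prop :=
  exists n a, irreducible J K n a
    /\ same J (fun x => sum_n (fun i => a i x * Cpow (g x) i) n) zero_fun.

(* In each of the three cases the field K(g) is closed under [Dx]. *)
Inductive elementary_field (J : R -> Prop) : ((R -> C) -> Prop) -> Prop :=
| elementary_field_rational : elementary_field J (rational_functions J)
| elementary_field_adjoin K g : elementary_field J K ->
    quotient_of_analytic J g ->
    exponential_over J K g \/ logarithmic_over J K g \/ algebraic_over J K g ->
    elementary_field J (adjoin J K g).

(* Smoothness makes the values of [F] on all of [J] determined by the element
   of the field which it represents. *)
Definition elementary_on (J : R -> Prop) (F : R -> C) : Prop :=
  smooth_on J F /\ exists2 K, elementary_field J K & K F.

(** * The linear equation and its solutions [V_j] *)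

Fixpoint iterated_operator (fs : nat -> R -> C) (m : nat) (w : R -> C) :
    R -> C :=
  match m with
  | 0%N => Dx w
  | m'.+1 => Dx (fun x => fs m x * iterated_operator fs m' w x)
  end.

(* Classical solutions of
   d_x f_{k-1} d_x ... d_x f_1 d_x P(u) = 0 on J. *)
Definition is_solution (k : nat) (fs : nat -> R -> C) (N : nat) (c : nat -> C)
    (J : R -> Prop) (u : R -> C) : Prop :=
  smooth_on J u /\
  forall x, J x ->
    iterated_operator fs k.-1 (fun y => Peval N c (u y)) x = 0.

Definition Rf (x0 : R) (fs : nat -> R -> C) (j : nat) (x : R) : C :=
  CInt (fun s => / fs j s) x0 x.

(* [g_iter m j] is g_{j-m:j}. *)
Fixpoint g_iter (x0 : R) (fs : nat -> R -> C) (m j : nat) (x : R) : C :=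
  match m with
  | 0%N => Rf x0 fs j x
  | m'.+1 => CInt (fun s => g_iter x0 fs m' j s / fs (j - m)%N s) x0 x
  end.

(* The value 1 for i > j gives the convention g_{2:1} = 1. *)
Definition gij (x0 : R) (fs : nat -> R -> C) (i j : nat) (x : R) : C :=
  if (i <= j)%N then g_iter x0 fs (j - i) j x else 1.

Definition Vj (x0 : R) (fs : nat -> R -> C) (f : R -> C) (j : nat) (x t : R) :
    C :=
  match j with
  | 1%N => f t * Rf x0 fs 1 x
  | _ => f t * CInt (fun s => gij x0 fs 2 j s / fs 1%N s) x0 x
  end.

Definition Liouville_criterion (I : R -> Prop) (x0 : R) (fs : nat -> R -> C)
    (j : nat) : Prop :=
  exists (n : nat) (c : nat -> C) (h : nat -> R -> C) (sigma : R -> C),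
    [/\ forall i, (1 <= i <= n)%N ->
          elementary_on I (h i) /\ forall x, I x -> h i x <> 0,
        elementary_on I sigma
      & forall x, I x ->
          gij x0 fs 2 j x / fs 1%N x
          = sum_n_m (fun i => c i * (Dx (h i) x / h i x)) 1 n + Dx sigma x].

(* Integrating by parts p+1 times expresses the integral of g_{2:j} / f_1
   through S, nu and the derivatives of g_{2:j}.  This criterion alone does not
   force g_{2:j} to be elementary: if f_1 = 1, nu = x^2/2, p = 1 and
   g_{2:2}'' = 2 e^x / x^2, then S = e^x, but g_{2:2}' is not elementary. *)
Definition parts_criterion (I : R -> Prop) (x0 : R) (fs : nat -> R -> C)
    (j : nat) : Prop :=
  exists (nu S : R -> C) (p : nat),
    [/\ elementary_on I nu, elementary_on I S, (0 < p)%N,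
        forall x, I x -> Dn p.+1 nu x = / fs 1%N x
      & forall x, I x -> Dx S x = Dn p.+1 (gij x0 fs 2 j) x * nu x].

(* [u = alpha(d(x))] for a holomorphic branch [alpha], on an open set [Omega],
   of the roots of P(u) - d = 0. *)
Definition root_branch (N : nat) (c : nat -> C) (Omega : C -> Prop)
    (alpha : C -> C) : Prop :=
  [/\ open Omega,
      forall d, Omega d ->
        ex_derive (K := C_AbsRing) (V := C_NormedModule) alpha d
    & forall d, Omega d -> Peval N c (alpha d) = d].

(* Main.v *)
Require Import Defs.
From Stdlib Require Import Reals Lra Lia Classical ClassicalEpsilon.
From Stdlib Require Import FunctionalExtensionality.
From Coquelicot Require Import Coquelicot.
From mathcomp Require Import all_boot all_algebra.
From mathcomp Require Import complex Rstruct zify.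

(** The linear operator undoes, one derivation at a time, the nested integrations
    that define [V_j], so it annihilates every combination [W] of the [V_j]
    ([iterated_operator_gij]); and P(alpha(W)) = W, since [alpha] is a branch of
    the roots of P(u) = d.  So alpha(W) solves the equation as soon as it is
    smooth, and what has to be shown is that it is elementary.

    [W] is elementary.  Under the Liouville criterion the integrand of [V_j] is
    a combination of logarithmic derivatives plus a derivative, and the primitive
    of h'/h is a logarithmic generator ([liouville_primitive]).  Under the other
    criterion, repeated integration by parts writes the primitive through [S] and
    the derivatives of [nu] and g_(2:j) ([parts_primitive]).  Elementary fields
    are closed under derivation ([elementary_Dx]), and two of them have a common
    elementary extension, also after restriction to a subinterval
    ([elementary_compositum]).

    alpha(W) is elementary.  It is a root of the polynomial P(u) - W over any
    elementary field that contains [W], so a polynomial of least degree which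
    vanishes at it is irreducible ([minimal_irreducible]) and alpha(W) is an
    algebraic generator ([root_branch_elementary]).

    A generator must moreover be a quotient of analytic functions of [x], and
    this is where analysis enters.  The derivative of P(alpha(d)) = d shows that
    P'(alpha(d)) is not zero ([root_branch_simple]), so that alpha(W) is analytic
    by the implicit function theorem for power series ([implicit_analytic_at]),
    whose formal solution converges because the fixed-point map preserves a ball
    of an l^1 norm ([formal_implicit]).  The same theorem gives reciprocals.
    The logarithms are analytic as primitives of analytic functions: a smooth
    function which is a quotient of analytic functions is analytic, since the
    orders of vanishing must allow the division ([real_analytic_div],
    [continuous_quotient_analytic]).

    Identities in a field of functions are checked at generic points, off the
    zeros of one nonzero analytic function ([generically]).  By the identity
    theorem on an interval such zeros are isolated, so generic properties can be
    combined and restricted to subintervals. *)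

Import Defs.

Set Implicit Arguments.
Unset Strict Implicit.
Unset Printing Implicit Defensive.

Local Open Scope R_scope.
#[local] Delimit Scope C_scope with C.

Lemma filter_imp_2 (T : Type) (F : (T -> Prop) -> Prop) {FF : Filter F}
    (P Q S : T -> Prop) :
  (forall x, P x -> Q x -> S x) -> F P -> F Q -> F S.
Proof.
by move=> h hP hQ; apply: filter_imp (filter_and _ _ hP hQ) => x []; exact: h.
Qed.

(** * Real-analytic germs *)

Definition real_analytic_at (f : R -> R) (x : R) : Prop :=
  exists a : nat -> R, locally x (fun y => is_pseries a (y - x) (f y)).

Lemma locally_ball_R (x : R) (P : R -> Prop) :
  locally x P <-> exists2 e : R, 0 < e & forall y, Rabs (y - x) < e -> P y.
Proof.
split; first by case=> e he; exists e; [exact: cond_pos | move=> y hy; exact: he].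
by case=> e e0 he; exists (mkposreal e e0) => y hy; exact: he.
Qed.

Lemma locally_CV (x : R) (a : nat -> R) :
  Rbar_lt 0 (CV_radius a) ->
  locally x (fun y => Rbar_lt (Rabs (y - x)) (CV_radius a)).
Proof.
move=> h; apply/locally_ball_R; case: (CV_radius a) h => [r||//] /= h.
- by exists r.
- by exists 1; [lra|].
Qed.

Lemma CV_radius_ge_pseries (a : nat -> R) (h l : R) :
  is_pseries a h l -> Rbar_le (Rabs h) (CV_radius a).
Proof.
move=> H; apply: Rbar_not_lt_le => /CV_disk_outside; apply.
have /ex_series_lim_0 : ex_series (fun n => a n * h ^ n)
  by exists l; apply/is_pseries_R.
by [].
Qed.

Lemma real_analytic_CV (x : R) (a : nat -> R) (f : R -> R) :
  locally x (fun y => is_pseries a (y - x) (f y)) -> Rbar_lt 0 (CV_radius a).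
Proof.
case/locally_ball_R => e e0 he.
have := he (x + e / 2); have -> : x + e / 2 - x = e / 2 by ring.
rewrite Rabs_pos_eq; last lra.
move=> /(_ ltac:(lra)) /CV_radius_ge_pseries; rewrite Rabs_pos_eq; last lra.
by apply: Rbar_lt_le_trans => /=; lra.
Qed.

Lemma is_pseries_PSeries_near (x : R) (a : nat -> R) :
  Rbar_lt 0 (CV_radius a) ->
  locally x (fun y => is_pseries a (y - x) (PSeries a (y - x))).
Proof.
move=> /(locally_CV x); apply: filter_imp => y /CV_radius_inside.
exact: PSeries_correct.
Qed.

Lemma real_analytic_atE (x : R) (a : nat -> R) (f : R -> R) :
  locally x (fun y => is_pseries a (y - x) (f y)) <->
  Rbar_lt 0 (CV_radius a) /\ locally x (fun y => f y = PSeries a (y - x)).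
Proof.
split=> [H|[H1 H2]].
  split; first exact: (real_analytic_CV H).
  by apply: filter_imp H => y /is_pseries_unique.
move: (is_pseries_PSeries_near x H1) H2; apply: filter_imp_2 => y.
by move=> ? ->.
Qed.

Lemma real_analytic_ext_loc (f g : R -> R) (x : R) :
  locally x (fun y => f y = g y) -> real_analytic_at f x -> real_analytic_at g x.
Proof.
move=> e [a ha]; exists a; move: e ha; apply: filter_imp_2 => y.
by move=> ->.
Qed.

Lemma real_analytic_PSeries (a : nat -> R) (x : R) :
  Rbar_lt 0 (CV_radius a) -> real_analytic_at (fun y => PSeries a (y - x)) x.
Proof. by move=> h; exists a; exact: is_pseries_PSeries_near. Qed.

Lemma real_analytic_const (c x : R) : real_analytic_at (fun _ => c) x.
Proof.
exists (fun n => match n with 0%N => c | _ => 0 end); apply: filter_forall => y.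
apply/is_pseries_R.
apply: (is_series_decr_1 (V := R_NormedModule)).
rewrite /plus /opp /=; have -> : c + - (c * 1) = 0 by ring.
apply: (is_series_ext (fun _ => 0)) => [n|]; first by rewrite Rmult_0_l.
by apply: filterlim_ext (filterlim_const 0) => n; rewrite sum_n_const Rmult_0_r.
Qed.

Lemma real_analytic_plus (f g : R -> R) (x : R) :
  real_analytic_at f x -> real_analytic_at g x -> real_analytic_at (fun y => f y + g y) x.
Proof.
move=> [a ha] [b hb]; exists (PS_plus a b); move: ha hb.
apply: filter_imp_2 => y; exact: is_pseries_plus.
Qed.

Lemma real_analytic_opp (f : R -> R) (x : R) : real_analytic_at f x ->
  real_analytic_at (fun y => - f y) x.
Proof.
move=> [a ha]; exists (PS_opp a); move: ha.
apply: filter_imp => y; exact: is_pseries_opp.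
Qed.

Lemma is_pseries_mult_near (x : R) (a b : nat -> R) (f g : R -> R) :
  locally x (fun y => is_pseries a (y - x) (f y)) ->
  locally x (fun y => is_pseries b (y - x) (g y)) ->
  locally x (fun y => is_pseries (PS_mult a b) (y - x) (f y * g y)).
Proof.
move=> ha hb.
have /(locally_CV x) ca := real_analytic_CV ha; have /(locally_CV x) cb := real_analytic_CV hb.
apply: (filter_imp_2 _ (filter_and _ _ ha hb) (filter_and _ _ ca cb)) => y [h1 h2] [h3 h4];
  exact: is_pseries_mult.
Qed.

Lemma real_analytic_mult (f g : R -> R) (x : R) :
  real_analytic_at f x -> real_analytic_at g x -> real_analytic_at (fun y => f y * g y) x.
Proof.
move=> [a ha] [b hb]; exists (PS_mult a b); exact: is_pseries_mult_near.
Qed.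

Lemma real_analytic_sub_id (x : R) : real_analytic_at (fun y => y - x) x.
Proof.
exists (fun n => match n with 0%N => 0 | 1%N => 1 | _ => 0 end).
have [a ha] := real_analytic_const 1 x.
apply: filter_forall => y.
have := is_pseries_incr_1 (fun n => match n with 0%N => 1 | _ => 0 end) (y - x) 1.
rewrite /scal /= /mult /= Rmult_1_r => H.
apply: is_pseries_ext (H _); first by case=> [|[|n]].
apply/is_pseries_R.
apply: (is_series_decr_1 (V := R_NormedModule)).
rewrite /plus /opp /=; have -> : 1 + - (1 * 1) = 0 by ring.
apply: (is_series_ext (fun _ => 0)) => [n|]; first by rewrite Rmult_0_l.
by apply: filterlim_ext (filterlim_const 0) => n; rewrite sum_n_const Rmult_0_r.
Qed.

Lemma real_analytic_id (x : R) : real_analytic_at (fun y => y) x.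
Proof.
apply: real_analytic_ext_loc (real_analytic_plus (real_analytic_sub_id x)
  (real_analytic_const x x)).
by apply: filter_forall => y; ring.
Qed.

Lemma is_derive_PSeries_shift (a : nat -> R) (x y : R) :
  Rbar_lt (Rabs (y - x)) (CV_radius a) ->
  is_derive (fun y => PSeries a (y - x)) y (PSeries (PS_derive a) (y - x)).
Proof.
move=> h; have -> : PSeries (PS_derive a) (y - x)
  = scal 1 (PSeries (PS_derive a) (y - x)) by rewrite /scal /= /mult /=; ring.
apply: (is_derive_comp (PSeries a) (fun y => y - x)).
  exact: is_derive_PSeries.
by auto_derive => //; ring.
Qed.

Lemma real_analytic_is_derive (f : R -> R) (x : R) :
  real_analytic_at f x -> exists2 g, real_analytic_at g x & locally x (fun y =>
    is_derive f y (g y)).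
Proof.
move=> [a /real_analytic_atE [ca ha]].
exists (fun y => PSeries (PS_derive a) (y - x)).
  by apply: real_analytic_PSeries; rewrite CV_radius_derive.
move: (locally_CV x ca) (locally_locally _ _ ha); apply: filter_imp_2 => y hy.
move=> e; apply: is_derive_ext_loc (is_derive_PSeries_shift hy).
by apply: filter_imp e => z ->.
Qed.

Lemma real_analytic_ex_derive (f : R -> R) (x : R) : real_analytic_at f x -> ex_derive f x.
Proof. by case/real_analytic_is_derive => g _ /locally_singleton h; exists (g x). Qed.

Lemma real_analytic_Derive (f : R -> R) (x : R) : real_analytic_at f x ->
  real_analytic_at (Derive f) x.
Proof.
case/real_analytic_is_derive => g hg h; apply: real_analytic_ext_loc hg.
by apply: filter_imp h => y /is_derive_unique ->.
Qed.

Lemma real_analytic_continuous (f : R -> R) (x : R) : real_analytic_at f x -> continuous f x.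
Proof. by move/real_analytic_ex_derive;
  exact: (ex_derive_continuous (V := R_NormedModule)). Qed.

Lemma real_analytic_primitive (F f : R -> R) (x : R) :
  locally x (fun y => is_derive F y (f y)) -> real_analytic_at f x -> real_analytic_at F x.
Proof.
move=> hF [a /real_analytic_atE [ca ha]].
set G := fun y => PSeries (PS_Int a) (y - x).
have cI : Rbar_lt 0 (CV_radius (PS_Int a)) by rewrite CV_radius_Int.
have hG : locally x (fun y => is_derive G y (f y)).
  move: (locally_CV x cI) ha; apply: filter_imp_2 => y /is_derive_PSeries_shift.
  move=> h ->; rewrite (PSeries_ext _ (PS_derive (PS_Int a))) => [//|n].
  rewrite /PS_derive /PS_Int; field; exact: not_0_INR.
have hD : locally x (fun y => is_derive (fun y => F y - G y) y zero).
  move: hF hG; apply: filter_imp_2 => y h1 h2.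
  have -> : zero = minus (f y) (f y) by rewrite minus_eq_zero.
  exact: (is_derive_minus (V := R_NormedModule) F G).
apply: (real_analytic_ext_loc _ (real_analytic_plus (real_analytic_PSeries x cI)
  (real_analytic_const (F x - G x) x))).
case/locally_ball_R: hD => e e0 he; apply/locally_ball_R; exists e => // y hy.
suff -> : F x - G x = F y - G y by rewrite /G; ring.
case: (Rtotal_order x y) => [lt|[->//|lt]].
- apply: (eq_is_derive (V := R_NormedModule) (fun y => F y - G y)) => // t tb.
  by apply: he; apply: Rabs_def1; case/Rabs_def2: hy; lra.
- symmetry.
  apply: (eq_is_derive (V := R_NormedModule) (fun y => F y - G y)) => // t tb.
  by apply: he; apply: Rabs_def1; case/Rabs_def2: hy; lra.
Qed.

Lemma PSeries_at_0 (a : nat -> R) (x : R) : PSeries a (x - x) = a 0%N.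
Proof. by rewrite Rminus_diag PSeries_0. Qed.

Lemma PSeries_factor (a : nat -> R) (x : R) :
  a 0%N = 0 -> forall y, PSeries a (y - x) = (y - x) * PSeries (PS_decr_1 a) (y - x).
Proof. by move=> a0 y; exact: PSeries_decr_1_aux. Qed.

Lemma real_analytic_factor (f : R -> R) (x : R) : real_analytic_at f x -> f x = 0 ->
  exists2 g, real_analytic_at g x & locally x (fun y => f y = (y - x) * g y).
Proof.
move=> [a /real_analytic_atE [ca ha]] f0.
exists (fun y => PSeries (PS_decr_1 a) (y - x)).
  by apply: real_analytic_PSeries; rewrite CV_radius_decr_1.
have a0 := locally_singleton _ _ ha.
apply: filter_imp ha => y ->; apply: PSeries_factor.
by rewrite -(PSeries_at_0 a x) -a0.
Qed.

(** The first nonzero coefficient gives the order [n] of a nonzero germ; the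
    factors [y - x] are split off one at a time, as in [real_analytic_factor]. *)
Lemma real_analytic_order (f : R -> R) (x : R) : real_analytic_at f x ->
  locally x (fun y => f y = 0) \/
  exists n g, [/\ real_analytic_at g x, g x <> 0 & locally x (fun y =>
    f y = (y - x) ^ n * g y)].
Proof.
move=> [a /real_analytic_atE [ca ha]].
case: (classic (exists n, a n <> 0)) => [[n an]|H]; last first.
  left; apply: filter_imp ha => y ->.
  rewrite (PSeries_ext _ (fun _ => 0)) ?PSeries_const_0 // => n.
  by apply: NNPP => h; apply: H; exists n.
elim/ltn_ind: n f a ca ha an => n IH f a ca ha an; right.
case: (classic (a 0%N = 0)) => a0; last first.
  exists 0%N, f; split; [by exists a; apply/real_analytic_atE | | ].
    by rewrite (locally_singleton _ _ ha) PSeries_at_0.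
  by apply: filter_forall => y; rewrite Rmult_1_l.
case: n IH an => [|n] IH an; first by [].
have cb : Rbar_lt 0 (CV_radius (PS_decr_1 a)) by rewrite CV_radius_decr_1.
have [||//|h|[m [g [hg g0 e]]]] :=
  IH n _ (fun y => PSeries (PS_decr_1 a) (y - x)) (PS_decr_1 a) cb.
- by [].
- exact: filter_forall.
- case: an; apply: (PSeries_ext_recip (PS_decr_1 a) (fun _ => 0) n cb).
    by rewrite CV_radius_const_0.
  case/locally_ball_R: h => r r0 h; apply/locally_ball_R; exists r => // t tb.
  rewrite PSeries_const_0 -(h (t + x)); first by congr PSeries; ring.
  by have -> : t + x - x = t - 0 by ring.
- exists m.+1, g; split=> //; move: ha e; apply: filter_imp_2 => y -> h.
  by rewrite (PSeries_factor _ a0) h /=; ring.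
Qed.

Lemma continuous_neq0 (f : R -> R) (x : R) :
  continuous f x -> f x <> 0 -> locally x (fun y => f y <> 0).
Proof.
move=> cf f0.
have h : locally (f x) (fun z => z <> 0).
  apply/locally_ball_R; exists (Rabs (f x)); first exact: Rabs_pos_lt.
  by move=> z hz z0; move: hz; rewrite z0 Rminus_0_l Rabs_Ropp; lra.
exact: cf h.
Qed.

Lemma real_analytic_isolated (f : R -> R) (x : R) : real_analytic_at f x ->
  locally x (fun y => f y = 0) \/ locally' x (fun y => f y <> 0).
Proof.
case/real_analytic_order => [|[n [g [/real_analytic_continuous cg g0 e]]]]; [by left | right].
move: (continuous_neq0 cg g0) e; apply: filter_imp_2 => y gy -> ne.
apply: Rmult_integral_contrapositive_currified => //.
by apply: pow_nonzero; lra.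
Qed.

Lemma locally_ex_neq (x : R) (P : R -> Prop) :
  locally x P -> exists2 y, y <> x & P y.
Proof.
case/locally_ball_R => r r0 hr; exists (x + r / 2); first lra.
by apply: hr; rewrite (_ : x + r / 2 - x = r / 2) ?Rabs_pos_eq; lra.
Qed.

Lemma continuous_punctured0 (k : R -> R) (x : R) :
  continuous k x -> locally' x (fun y => k y = 0) -> locally x (fun y => k y = 0).
Proof.
move=> ck k0.
have kx : k x = 0.
  apply: NNPP => /(continuous_neq0 ck) h.
  have /locally_ex_neq [y ne [h1 h2]] : locally x (fun y => k y <> 0 /\ (y <> x -> k y = 0)).
    exact: filter_and h k0.
  by apply: h1; exact: h2.
apply: (filter_imp _ _ _ (k0 : locally x (fun y => y <> x -> k y = 0))) => y hy.
by case: (Req_dec y x) => [->|ne]; [exact: kx | exact: hy].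
Qed.

(** * Formal solution of an implicit equation *)

Definition re_part (T : Type) (f : T -> C) : T -> R := fun x => fst (f x).
Definition im_part (T : Type) (f : T -> C) : T -> R := fun x => snd (f x).

(** Truncating at [k] makes sense for every sequence, and is compatible with
    products; the convergence radius is positive iff these sums are bounded
    for some [r > 0]. *)
Definition trunc_norm (r : R) (a : nat -> R) (k : nat) : R :=
  sum_f_R0 (fun n => Rabs (a n) * r ^ n) k.

Lemma trunc_norm_ge0 (r : R) (a : nat -> R) (k : nat) : 0 <= r -> 0 <= trunc_norm r a k.
Proof.
move=> r0; apply: cond_pos_sum => n.
by apply: Rmult_le_pos; [exact: Rabs_pos | exact: pow_le].
Qed.

Lemma sum_f_R0_le_mult (A B : nat -> R) (k : nat) :
  (forall n, 0 <= A n) -> (forall n, 0 <= B n) ->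
  sum_f_R0 (fun n => sum_f_R0 (fun i => A i * B (n - i)%coq_nat) n) k
  <= sum_f_R0 A k * sum_f_R0 B k.
Proof.
move=> hA hB; case: k => [|k]; first by rewrite /=; apply: Rle_refl.
rewrite cauchy_finite; last by lia.
rewrite -[X in X <= _]Rplus_0_r; apply: Rplus_le_compat_l.
by apply: cond_pos_sum => i; apply: cond_pos_sum => l; apply: Rmult_le_pos.
Qed.

Lemma trunc_norm_mult (r : R) (a b : nat -> R) (k : nat) : 0 <= r ->
  trunc_norm r (PS_mult a b) k <= trunc_norm r a k * trunc_norm r b k.
Proof.
move=> r0.
apply: Rle_trans (sum_f_R0_le_mult k _ _).
- apply: sum_Rle => n _; rewrite /PS_mult.
  apply: Rle_trans (Rmult_le_compat_r _ _ _ (pow_le _ n r0) (Rsum_abs _ _)) _.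
  rewrite Rmult_comm scal_sum; apply: sum_Rle => i hi.
  have e : r ^ n = r ^ i * r ^ (n - i)%coq_nat by rewrite -pow_add; congr pow; lia.
  by rewrite Rabs_mult e; apply: Req_le; ring.
- by move=> n; apply: Rmult_le_pos; [exact: Rabs_pos | exact: pow_le].
- by move=> n; apply: Rmult_le_pos; [exact: Rabs_pos | exact: pow_le].
Qed.

Lemma trunc_norm_plus (r : R) (a b : nat -> R) (k : nat) : 0 <= r ->
  trunc_norm r (fun n => a n + b n) k <= trunc_norm r a k + trunc_norm r b k.
Proof.
move=> r0; rewrite /trunc_norm -sum_plus; apply: sum_Rle => n _.
rewrite -Rmult_plus_distr_r; apply: Rmult_le_compat_r; first exact: pow_le.
exact: Rabs_triang.
Qed.

Lemma trunc_norm_opp (r : R) (a : nat -> R) (k : nat) :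
  trunc_norm r (fun n => - a n) k = trunc_norm r a k.
Proof. by rewrite /trunc_norm; apply: PartSum.sum_eq => n _; rewrite Rabs_Ropp. Qed.

Lemma trunc_norm_le (r s : R) (a : nat -> R) (k : nat) : 0 <= r <= s ->
  trunc_norm r a k <= trunc_norm s a k.
Proof.
move=> h; rewrite /trunc_norm; apply: sum_Rle => n _; apply: Rmult_le_compat_l;
  first exact: Rabs_pos.
exact: pow_incr.
Qed.

(** A power series without constant term has a small norm on a small disk. *)
Lemma trunc_norm_small (r s : R) (a : nat -> R) (k : nat) : 0 <= r <= s -> 0 < s ->
  a 0%N = 0 -> trunc_norm r a k <= r / s * trunc_norm s a k.
Proof.
move=> h s0 a0; rewrite /trunc_norm scal_sum; apply: sum_Rle => -[|n] _.
  by rewrite a0 Rabs_R0; lra.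
rewrite Rmult_assoc; apply: Rmult_le_compat_l; first exact: Rabs_pos.
rewrite /= (_ : s * s ^ n * (r / s) = r * s ^ n); last by field; lra.
by apply: Rmult_le_compat_l; [lra | exact: pow_incr].
Qed.

Lemma trunc_norm_bounded (a : nat -> R) : Rbar_lt 0 (CV_radius a) ->
  exists r M, [/\ 0 < r, 0 <= M & forall k, trunc_norm r a k <= M].
Proof.
move=> /(locally_CV 0) /locally_ball_R [e e0 he].
have hr : Rbar_lt (Rabs (e / 2)) (CV_radius a).
  have -> : e / 2 = e / 2 - 0 by ring.
  by apply: he; rewrite Rabs_pos_eq; lra.
have /ex_series_Reals_0 [l hl] := CV_disk_inside _ _ hr.
have e2 : 0 <= e / 2 by lra.
have E k : trunc_norm (e / 2) a k = sum_f_R0 (fun n => Rabs (a n * (e / 2) ^ n)) k.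
  by rewrite /trunc_norm; apply: PartSum.sum_eq => n _;
    rewrite Rabs_mult (Rabs_pos_eq ((e/2)^n)) //; exact: pow_le.
exists (e / 2), l; have H k : trunc_norm (e / 2) a k <= l.
  by rewrite E; apply: (sum_incr _ _ _ hl) => n; exact: Rabs_pos.
split=> //; first by lra.
by apply: Rle_trans (H 0%N); exact: trunc_norm_ge0.
Qed.

Lemma CV_radius_trunc_norm (a : nat -> R) (r M : R) : 0 < r ->
  (forall k, trunc_norm r a k <= M) -> Rbar_lt 0 (CV_radius a).
Proof.
move=> r0 H; apply: (Rbar_lt_le_trans _ r) => //.
have [h _] := CV_radius_bounded a; apply: h; exists M => n.
apply: Rle_trans (H n); rewrite Rabs_mult (Rabs_pos_eq (r ^ n)); last by apply: pow_le; lra.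
have p m : 0 <= Rabs (a m) * r ^ m.
  by apply: Rmult_le_pos; [exact: Rabs_pos | apply: pow_le; lra].
case: n => [|n]; first exact: Rle_refl.
rewrite /trunc_norm /=; have := cond_pos_sum _ n p; lra.
Qed.

(** The product of power series with complex coefficients, by coordinates, so
    that the convergence theory of real power series applies to it. *)
Definition cauchy_product (a b : nat -> C) : nat -> C := fun n =>
  (PS_mult (re_part a) (re_part b) n - PS_mult (im_part a) (im_part b) n,
   PS_mult (re_part a) (im_part b) n + PS_mult (im_part a) (re_part b) n).

(** The norm |Re| + |Im| on coefficients is submultiplicative, so this norm is
    too. *)
Definition ctrunc_norm (r : R) (a : nat -> C) (k : nat) : R :=
  trunc_norm r (re_part a) k + trunc_norm r (im_part a) k.

Lemma ctrunc_norm_ge0 (r : R) (a : nat -> C) (k : nat) : 0 <= r -> 0 <= ctrunc_norm r a k.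
Proof. by move=> r0; apply: Rplus_le_le_0_compat; exact: trunc_norm_ge0. Qed.

Lemma ctrunc_norm_0 (r : R) (k : nat) : ctrunc_norm r (fun _ => RtoC 0) k = 0.
Proof.
have E : trunc_norm r (fun _ => 0) k = 0.
  rewrite /trunc_norm (PartSum.sum_eq _ (fun _ => 0)) => [|i _]; first by rewrite sum_cte; ring.
  by rewrite Rabs_R0 Rmult_0_l.
by rewrite /ctrunc_norm /re_part /im_part /= E Rplus_0_r.
Qed.

Lemma ctrunc_norm_cauchy_product (r : R) (a b : nat -> C) (k : nat) : 0 <= r ->
  ctrunc_norm r (cauchy_product a b) k <= ctrunc_norm r a k * ctrunc_norm r b k.
Proof.
move=> r0; rewrite /ctrunc_norm.
have := trunc_norm_mult (re_part a) (re_part b) k r0;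
  have := trunc_norm_mult (im_part a) (im_part b) k r0.
have := trunc_norm_mult (re_part a) (im_part b) k r0;
  have := trunc_norm_mult (im_part a) (re_part b) k r0.
have := trunc_norm_plus (PS_mult (re_part a) (re_part b))
  (fun n => - PS_mult (im_part a) (im_part b) n) k r0.
have := trunc_norm_plus (PS_mult (re_part a) (im_part b)) (PS_mult (im_part a)
  (re_part b)) k r0.
rewrite trunc_norm_opp.
change (re_part (cauchy_product a b)) with (fun n =>
  PS_mult (re_part a) (re_part b) n + - PS_mult (im_part a) (im_part b) n).
change (im_part (cauchy_product a b)) with (fun n =>
  PS_mult (re_part a) (im_part b) n + PS_mult (im_part a) (re_part b) n).
lra.
Qed.

Lemma ctrunc_norm_plus (r : R) (a b : nat -> C) (k : nat) : 0 <= r ->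
  ctrunc_norm r (fun n => (a n + b n)%C) k <= ctrunc_norm r a k + ctrunc_norm r b k.
Proof.
move=> r0; have := trunc_norm_plus (re_part a) (re_part b) k r0.
have := trunc_norm_plus (im_part a) (im_part b) k r0.
rewrite /ctrunc_norm /re_part /im_part /=; lra.
Qed.

Lemma ctrunc_norm_le (r s : R) (a : nat -> C) (k : nat) : 0 <= r <= s ->
  ctrunc_norm r a k <= ctrunc_norm s a k.
Proof. by move=> h; apply: Rplus_le_compat; exact: trunc_norm_le. Qed.

Lemma ctrunc_norm_small (r s : R) (a : nat -> C) (k : nat) : 0 <= r <= s -> 0 < s ->
  a 0%N = RtoC 0 -> ctrunc_norm r a k <= r / s * ctrunc_norm s a k.
Proof.
move=> h s0 a0; rewrite /ctrunc_norm Rmult_plus_distr_l.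
by apply: Rplus_le_compat; apply: trunc_norm_small; rewrite // /re_part /im_part a0.
Qed.

Definition agree (n : nat) (a b : nat -> C) : Prop :=
  forall i, (i < n)%N -> a i = b i.

Lemma ctrunc_norm_agree (r : R) (a b : nat -> C) (k : nat) :
  agree k.+1 a b -> ctrunc_norm r a k = ctrunc_norm r b k.
Proof.
move=> h; rewrite /ctrunc_norm /trunc_norm; congr Rplus; apply: PartSum.sum_eq => i hi;
  rewrite /re_part /im_part h //; lia.
Qed.

Lemma PS_mult_agree (n : nat) (a a' b b' : nat -> R) :
  (forall i, (i < n)%N -> a i = a' i) -> (forall i, (i < n)%N -> b i = b' i) ->
  forall i, (i < n)%N -> PS_mult a b i = PS_mult a' b' i.
Proof. by move=> ha hb i hi; rewrite /PS_mult; apply: PartSum.sum_eq => k hk;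
  rewrite ha ?hb //; lia. Qed.

(** Without constant terms the product has one more known coefficient than its
    factors. *)
Lemma PS_mult_agreeS (n : nat) (a a' b b' : nat -> R) :
  (forall i, (i < n)%N -> a i = a' i) -> (forall i, (i < n)%N -> b i = b' i) ->
  a 0%N = 0 -> a' 0%N = 0 -> b 0%N = 0 -> b' 0%N = 0 ->
  forall i, (i < n.+1)%N -> PS_mult a b i = PS_mult a' b' i.
Proof.
move=> ha hb a0 a'0 b0 b'0 i hi; rewrite /PS_mult; apply: PartSum.sum_eq => k hk.
case: (posnP k) => [->|k0]; first by rewrite a0 a'0 !Rmult_0_l.
case: (ltnP k i) => hki; last first.
  by rewrite (_ : (i - k)%coq_nat = 0%N) ?b0 ?b'0 ?Rmult_0_r //; lia.
by rewrite ha ?hb //; lia.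
Qed.

Lemma cauchy_product_agree (n : nat) (a a' b b' : nat -> C) :
  agree n a a' -> agree n b b' -> agree n (cauchy_product a b) (cauchy_product a' b').
Proof.
move=> ha hb i hi.
have h (f : nat -> C) f' : agree n f f' ->
  (forall j, (j < n)%N -> re_part f j = re_part f' j) /\
  (forall j, (j < n)%N -> im_part f j = im_part f' j).
  by move=> hf; split=> j hj; rewrite /re_part /im_part hf.
have [ra ia] := h _ _ ha; have [rb ib] := h _ _ hb; rewrite /cauchy_product.
by congr pair; [congr Rminus | congr Rplus]; apply: (PS_mult_agree (n := n)).
Qed.

Lemma cauchy_product_agreeS (n : nat) (a a' b b' : nat -> C) :
  agree n a a' -> agree n b b' ->
  a 0%N = RtoC 0 -> a' 0%N = RtoC 0 -> b 0%N = RtoC 0 -> b' 0%N = RtoC 0 ->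
  agree n.+1 (cauchy_product a b) (cauchy_product a' b').
Proof.
move=> ha hb a0 a'0 b0 b'0 i hi.
have h (f : nat -> C) f' : agree n f f' ->
  (forall j, (j < n)%N -> re_part f j = re_part f' j) /\
  (forall j, (j < n)%N -> im_part f j = im_part f' j).
  by move=> hf; split=> j hj; rewrite /re_part /im_part hf.
have [ra ia] := h _ _ ha; have [rb ib] := h _ _ hb; rewrite /cauchy_product.
by congr pair; [congr Rminus | congr Rplus]; apply: (PS_mult_agreeS (n := n));
  rewrite // /re_part /im_part ?a0 ?a'0 ?b0 ?b'0.
Qed.

Lemma cauchy_product_0 (a b : nat -> C) : a 0%N = RtoC 0 -> cauchy_product a b 0%N = RtoC 0.
Proof.
move=> a0; rewrite /cauchy_product /PS_mult /= /re_part /im_part a0 /=.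
by rewrite !Rmult_0_l Rminus_0_r Rplus_0_r.
Qed.

(** The power series q_0 + z (q_1 + z (q_2 + ...)). *)
Fixpoint nest_series (qs : seq (nat -> C)) (z : nat -> C) : nat -> C :=
  match qs with
  | [::] => fun _ => RtoC 0
  | q :: qs' => fun n => (q n + cauchy_product z (nest_series qs' z) n)%C
  end.

Lemma nest_series_cons (q : nat -> C) (qs : seq (nat -> C)) (z : nat -> C) :
  nest_series (q :: qs) z = fun n => (q n + cauchy_product z (nest_series qs z) n)%C.
Proof. by []. Qed.

Lemma nest_series_agree (n : nat) (qs : seq (nat -> C)) (z w : nat -> C) :
  agree n z w -> agree n (nest_series qs z) (nest_series qs w).
Proof.
move=> h; elim: qs => [|q qs IH] //= i hi.
by congr Cplus; apply: cauchy_product_agree hi.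
Qed.

Lemma ctrunc_norm_nest_series (r M : R) (k : nat) (qs : seq (nat -> C)) (z : nat -> C) :
  0 <= r -> List.Forall (fun q => forall k, ctrunc_norm r q k <= M) qs ->
  ctrunc_norm r z k <= 1 -> ctrunc_norm r (nest_series qs z) k <= M * INR (size qs).
Proof.
move=> r0 h hz; elim: h => [|q {}qs hq _ IH].
  by rewrite /= Rmult_0_r ctrunc_norm_0; exact: Rle_refl.
rewrite nest_series_cons [size _]/= S_INR; apply: Rle_trans (ctrunc_norm_plus _ _ _ r0) _.
have h1 := ctrunc_norm_cauchy_product z (nest_series qs z) k r0; have := hq k.
have h2 : ctrunc_norm r z k * ctrunc_norm r (nest_series qs z) k <= 1 * ctrunc_norm r
  (nest_series qs z) k.
  by apply: Rmult_le_compat_r => //; exact: ctrunc_norm_ge0.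
lra.
Qed.

(** The equation [z = q0 + z (q1 + z (...))] determines each coefficient of [z]
    by the previous ones, as [q0], [q1] and [z] have no constant term.  So the
    iterates of the right-hand side, started at 0, stabilise coefficientwise.
    They stay in a ball of the truncated [l^1] norms of a small radius [r],
    since there [q0] and [q1] are small. *)
Lemma formal_implicit (r0 M : R) (q0 q1 : nat -> C) (qs : seq (nat -> C)) :
  0 < r0 -> 0 <= M ->
  List.Forall (fun q => forall k, ctrunc_norm r0 q k <= M) [:: q0, q1 & qs] ->
  q0 0%N = RtoC 0 -> q1 0%N = RtoC 0 ->
  exists z r, [/\ 0 < r, forall k, ctrunc_norm r z k <= 1, z 0%N = RtoC 0
    & z = nest_series [:: q0, q1 & qs] z].
Proof.
move=> hr0 hM hq hq0 hq1.
pose T := nest_series [:: q0, q1 & qs].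
have T0 z : z 0%N = RtoC 0 -> T z 0%N = RtoC 0.
  by move=> z0; rewrite /T !nest_series_cons hq0 cauchy_product_0 // Cplus_0_r.
have TS n z w : z 0%N = RtoC 0 -> w 0%N = RtoC 0 ->
    agree n z w -> agree n.+1 (T z) (T w).
  move=> z0 w0 h i hi; rewrite /T !nest_series_cons; congr Cplus.
  apply: cauchy_product_agreeS hi => //.
  - by move=> j hj; congr Cplus; apply: cauchy_product_agree hj => //; exact: nest_series_agree.
  - by rewrite hq1 cauchy_product_0 // Cplus_0_r.
  - by rewrite hq1 cauchy_product_0 // Cplus_0_r.
pose u k := iter k T (fun _ => RtoC 0).
have u0 k : u k 0%N = RtoC 0 by elim: k => [|k IH] //; exact: T0.
have uS k : agree k (u k) (u k.+1).
  elim: k => [|k IH]; first by move=> i; rewrite ltn0.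
  exact: (TS k _ _ (u0 k) (u0 k.+1) IH).
have um k m : (k <= m)%N -> agree k (u k) (u m).
  move=> h; rewrite -(subnKC h); elim: (m - k)%N => [|d IH]; first by rewrite addn0.
  by move=> i hi; rewrite IH // addnS; apply: uS; lia.
pose z n := u n.+1 n.
have zu n : agree n z (u n) by move=> i hi; rewrite /z (um i.+1 n hi).
pose m := INR (size qs).
have m0 : 0 <= m by exact: pos_INR.
pose e := / (1 + 4 * (M * m)).
have Mm : 0 <= M * m by exact: Rmult_le_pos.
have e0 : 0 < e by apply: Rinv_0_lt_compat; lra.
have eE : e * (1 + 4 * (M * m)) = 1 by rewrite /e; field; lra.
have e1 : e <= 1.
  have : 0 <= e * (4 * (M * m)) by apply: Rmult_le_pos; lra.
  lra.
have eMm : e * (M * m) <= / 4.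
  have -> : e * (M * m) = (1 - e) / 4 by lra.
  lra.
(* On the ball of radius [e], the terms z z (...) have norm at most
   e e M m <= e / 4; [d] is small enough for [q0] and z [q1] to keep the sum
   below [e], and the radius [r] is then chosen such that [q0] and [q1] have
   norm at most [d]. *)
pose d := Rmin (e / 2) (/ 4).
have d0 : 0 < d by apply: Rmin_glb_lt; lra.
have d1 : d <= e / 2 by exact: Rmin_l.
have d2 : d <= / 4 by exact: Rmin_r.
pose r := Rmin r0 (r0 * d / (M + 1)).
have rr : 0 < r0 * d / (M + 1).
  by apply: Rdiv_lt_0_compat; [exact: Rmult_lt_0_compat | lra].
have r1 : 0 < r by apply: Rmin_glb_lt.
have r2 : 0 <= r <= r0 by split; [lra | exact: Rmin_l].
have r3 : r / r0 * M <= d.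
  apply: (Rle_trans _ (r0 * d / (M + 1) / r0 * M)).
    apply: Rmult_le_compat_r => //; apply: Rmult_le_compat_r; last exact: Rmin_r.
    by apply: Rlt_le; exact: Rinv_0_lt_compat.
  have -> : r0 * d / (M + 1) / r0 * M = d - d / (M + 1) by field; lra.
  have : 0 < d / (M + 1) by apply: Rdiv_lt_0_compat; lra.
  lra.
have small q : (forall k, ctrunc_norm r0 q k <= M) -> q 0%N = RtoC 0 ->
    forall k, ctrunc_norm r q k <= d.
  move=> h h0 k; apply: Rle_trans (ctrunc_norm_small k r2 hr0 h0) _.
  apply: Rle_trans r3; apply: Rmult_le_compat_l (h k).
  by apply: Rdiv_le_0_compat; lra.
have hq0' := small _ (List.Forall_inv hq) hq0.
have hq' := List.Forall_inv_tail hq.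
have hq1' := small _ (List.Forall_inv hq') hq1.
have hqs : List.Forall (fun q => forall k, ctrunc_norm r q k <= M) qs.
  apply: List.Forall_impl (List.Forall_inv_tail hq') => q h k.
  exact: Rle_trans (ctrunc_norm_le _ _ r2) (h k).
have rge : 0 <= r by lra.
have ub k j : ctrunc_norm r (u k) j <= e.
  elim: k => [|k IH].
    by rewrite /u /= ctrunc_norm_0; lra.
  rewrite [u _]/= -/(u k) /T !nest_series_cons.
  set A := fun n => (q1 n + _)%C.
  have hA : ctrunc_norm r A j <= d + e * (M * m).
    apply: Rle_trans (ctrunc_norm_plus _ _ _ rge) _; apply: Rplus_le_compat => //.
    apply: Rle_trans (ctrunc_norm_cauchy_product _ _ _ rge) _.
    apply: Rmult_le_compat => //; try exact: ctrunc_norm_ge0.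
    by apply: ctrunc_norm_nest_series => //; lra.
  apply: Rle_trans (ctrunc_norm_plus _ _ _ rge) _.
  have h := ctrunc_norm_cauchy_product (u k) A j rge; have := hq0' j.
  have : ctrunc_norm r (u k) j * ctrunc_norm r A j <= e * (/ 2).
    apply: Rmult_le_compat; try exact: ctrunc_norm_ge0; lra.
  lra.
exists z, r; split=> //.
- by move=> k; rewrite (ctrunc_norm_agree _ (zu k.+1)); apply: Rle_trans (ub _ _) e1.
- exact: u0.
- apply: functional_extensionality => n; rewrite -/(T z).
  rewrite (_ : z n = u n.+2 n); last by rewrite /z (uS n.+1).
  symmetry; apply: (TS n.+1 z (u n.+1) (u0 1%N) (u0 n.+1) (zu n.+1)).
  exact: ltnW.
Qed.

(** * The implicit function theorem for complex-valued germs *)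

Definition analytic_at (F : R -> C) (x : R) :
  Prop := real_analytic_at (re_part F) x /\ real_analytic_at (im_part F) x.

Definition expands_as (x : R) (a : nat -> C) (F : R -> C) : Prop :=
  locally x (fun y => is_pseries (re_part a) (y - x) (re_part F y)) /\
  locally x (fun y => is_pseries (im_part a) (y - x) (im_part F y)).

Lemma analytic_at_expands (F : R -> C) (x : R) : analytic_at F x <-> exists a, expands_as x a F.
Proof.
split; last by case=> a [h1 h2]; split; eexists; eassumption.
by case=> [[a ha] [b hb]]; exists (fun n => (a n, b n)); split.
Qed.

Lemma analytic_at_ext_loc (F G : R -> C) (x : R) :
  locally x (fun y => F y = G y) -> analytic_at F x -> analytic_at G x.
Proof.
move=> e [h1 h2]; split; [apply: real_analytic_ext_loc h1 | apply: real_analytic_ext_loc h2].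
- by apply: filter_imp e => y; rewrite /re_part => ->.
- by apply: filter_imp e => y; rewrite /im_part => ->.
Qed.

Lemma analytic_at_const (c : C) (x : R) : analytic_at (fun _ => c) x.
Proof. by split; exact: real_analytic_const. Qed.

Lemma analytic_at_RtoC (f : R -> R) (x : R) : real_analytic_at f x ->
  analytic_at (fun y => RtoC (f y)) x.
Proof. by move=> h; split=> //; exact: real_analytic_const. Qed.

Lemma analytic_at_plus (F G : R -> C) (x : R) :
  analytic_at F x -> analytic_at G x -> analytic_at (fun y => (F y + G y)%C) x.
Proof. by move=> [h1 h2] [h3 h4]; split; exact: real_analytic_plus. Qed.

Lemma analytic_at_opp (F : R -> C) (x : R) : analytic_at F x ->
  analytic_at (fun y => (- F y)%C) x.
Proof. by move=> [h1 h2]; split; exact: real_analytic_opp. Qed.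

Lemma analytic_at_minus (F G : R -> C) (x : R) :
  analytic_at F x -> analytic_at G x -> analytic_at (fun y => (F y - G y)%C) x.
Proof. by move=> h1 h2; apply: analytic_at_plus => //; exact: analytic_at_opp. Qed.

Lemma analytic_at_mult (F G : R -> C) (x : R) :
  analytic_at F x -> analytic_at G x -> analytic_at (fun y => (F y * G y)%C) x.
Proof.
move=> [h1 h2] [h3 h4]; split.
- by apply: real_analytic_plus; [|apply: real_analytic_opp]; exact: real_analytic_mult.
- by apply: real_analytic_plus; exact: real_analytic_mult.
Qed.

Lemma analytic_at_Dx (F : R -> C) (x : R) : analytic_at F x -> analytic_at (Dx F) x.
Proof. by move=> [h1 h2]; split; exact: real_analytic_Derive. Qed.

Definition ccontinuous (F : R -> C) (x : R) : Prop :=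
  continuous (re_part F) x /\ continuous (im_part F) x.

Lemma analytic_at_ccontinuous (F : R -> C) (x : R) : analytic_at F x -> ccontinuous F x.
Proof. by move=> [h1 h2]; split; exact: real_analytic_continuous. Qed.

Lemma ccontinuous_const (c : C) (x : R) : ccontinuous (fun _ => c) x.
Proof. by split; exact: continuous_const. Qed.

Lemma ccontinuous_plus (F G : R -> C) (x : R) :
  ccontinuous F x -> ccontinuous G x -> ccontinuous (fun y => (F y + G y)%C) x.
Proof.
move=> [h1 h2] [h3 h4]; split.
- exact: (continuous_plus (V := R_NormedModule) (re_part F) (re_part G)).
- exact: (continuous_plus (V := R_NormedModule) (im_part F) (im_part G)).
Qed.

Lemma ccontinuous_opp (F : R -> C) (x : R) : ccontinuous F x ->
  ccontinuous (fun y => (- F y)%C) x.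
Proof.
move=> [h1 h2]; split.
- exact: (continuous_opp (V := R_NormedModule) (re_part F)).
- exact: (continuous_opp (V := R_NormedModule) (im_part F)).
Qed.

Lemma ccontinuous_mult (F G : R -> C) (x : R) :
  ccontinuous F x -> ccontinuous G x -> ccontinuous (fun y => (F y * G y)%C) x.
Proof.
move=> [h1 h2] [h3 h4]; split.
- apply: (continuous_minus (V := R_NormedModule)
    (fun y => re_part F y * re_part G y) (fun y => im_part F y * im_part G y)).
  + exact: (continuous_mult (K := R_AbsRing) (re_part F) (re_part G)).
  + exact: (continuous_mult (K := R_AbsRing) (im_part F) (im_part G)).
- apply: (continuous_plus (V := R_NormedModule)
    (fun y => re_part F y * im_part G y) (fun y => im_part F y * re_part G y)).
  + exact: (continuous_mult (K := R_AbsRing) (re_part F) (im_part G)).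
  + exact: (continuous_mult (K := R_AbsRing) (im_part F) (re_part G)).
Qed.

Lemma C_normsq_eq0 (z : C) : fst z * fst z + snd z * snd z = 0 -> z = RtoC 0.
Proof.
case: z => p q /= h; have := Rle_0_sqr p; have := Rle_0_sqr q; rewrite /Rsqr => i1 i2.
by congr pair; apply: Rsqr_0_uniq; rewrite /Rsqr; lra.
Qed.

Lemma ccontinuous_inv (F : R -> C) (x : R) :
  ccontinuous F x -> F x <> RtoC 0 -> ccontinuous (fun y => (/ F y)%C) x.
Proof.
move=> [c1 c2] n0.
pose d y := re_part F y * re_part F y + im_part F y * im_part F y.
have cd : continuous d x.
  apply: (continuous_plus (V := R_NormedModule) (fun y => re_part F y * re_part F y)
    (fun y => im_part F y * im_part F y)).
  - exact: (continuous_mult (K := R_AbsRing) (re_part F) (re_part F)).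
  - exact: (continuous_mult (K := R_AbsRing) (im_part F) (im_part F)).
have nd : d x <> 0 by move/C_normsq_eq0.
have ci := continuous_Rinv_comp d x cd nd.
split.
- apply: (continuous_ext (fun y => re_part F y * / d y)) => [y|].
    by rewrite /d /re_part /im_part /Cinv /= !Rmult_1_r.
  exact: (continuous_mult (K := R_AbsRing) (re_part F) (fun y => / d y)).
- apply: (continuous_ext (fun y => - im_part F y * / d y)) => [y|].
    by rewrite /d /re_part /im_part /Cinv /= !Rmult_1_r.
  apply: (continuous_mult (K := R_AbsRing) (fun y => - im_part F y) (fun y => / d y)) => //.
  exact: (continuous_opp (V := R_NormedModule) (im_part F)).
Qed.

Lemma C_eq0 (z : C) : fst z = 0 -> snd z = 0 -> z = RtoC 0.
Proof. by case: z => a b /= -> ->. Qed.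

Lemma ccontinuous_neq0 (F : R -> C) (x : R) :
  ccontinuous F x -> F x <> RtoC 0 -> locally x (fun y => F y <> RtoC 0).
Proof.
move=> [h1 h2] hx; case: (Req_dec (re_part F x) 0) => [e|ne].
- have ne : im_part F x <> 0 by move=> e'; apply: hx; exact: C_eq0.
  by apply: filter_imp (continuous_neq0 h2 ne) => y h e'; apply: h; rewrite /im_part e'.
- by apply: filter_imp (continuous_neq0 h1 ne) => y h e'; apply: h; rewrite /re_part e'.
Qed.

(** The function [y |-> q_0 + z (q_1 + z (q_2 + ...))]. *)
Fixpoint nest (qs : seq (R -> C)) (z : R -> C) (y : R) : C :=
  match qs with
  | [::] => RtoC 0
  | q :: qs' => (q y + z y * nest qs' z y)%C
  end.

(** The divided difference of [nest] in its argument [z]; see [nest_minus]. *)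
Fixpoint nest_diff (qs : seq (R -> C)) (z w : R -> C) (y : R) : C :=
  match qs with
  | [::] => RtoC 0
  | q :: qs' => (nest qs' z y + w y * nest_diff qs' z w y)%C
  end.

Lemma nest_minus (qs : seq (R -> C)) (z w : R -> C) (y : R) :
  (nest qs z y - nest qs w y = (z y - w y) * nest_diff qs z w y)%C.
Proof.
elim: qs => [|q qs IH] /=; first by ring.
transitivity ((z y - w y) * nest qs z y + w y * (nest qs z y - nest qs w y))%C; first by ring.
by rewrite IH; ring.
Qed.

Lemma ccontinuous_nest (qs : seq (R -> C)) (z : R -> C) (x : R) :
  List.Forall (fun q => ccontinuous q x) qs -> ccontinuous z x -> ccontinuous (nest qs z) x.
Proof.
move=> h hz; elim: h => [|q {}qs hq _ IH]; first exact: ccontinuous_const.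
by apply: ccontinuous_plus => //; exact: ccontinuous_mult.
Qed.

Lemma ccontinuous_nest_diff (qs : seq (R -> C)) (z w : R -> C) (x : R) :
  List.Forall (fun q => ccontinuous q x) qs -> ccontinuous z x -> ccontinuous w x ->
  ccontinuous (nest_diff qs z w) x.
Proof.
move=> h hz hw; elim: h => [|q {}qs hq hqs IH]; first exact: ccontinuous_const.
by apply: ccontinuous_plus; [exact: ccontinuous_nest | exact: ccontinuous_mult].
Qed.

Lemma expands_as_plus (x : R) (a b : nat -> C) (F G : R -> C) :
  expands_as x a F -> expands_as x b G ->
    expands_as x (fun n => (a n + b n)%C) (fun y => (F y + G y)%C).
Proof.
move=> [h1 h2] [h3 h4]; split.
- by apply: (filter_imp_2 _ h1 h3) => y; exact: is_pseries_plus.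
- by apply: (filter_imp_2 _ h2 h4) => y; exact: is_pseries_plus.
Qed.

Lemma expands_as_cauchy_product (x : R) (a b : nat -> C) (F G : R -> C) :
  expands_as x a F -> expands_as x b G ->
    expands_as x (cauchy_product a b) (fun y => (F y * G y)%C).
Proof.
move=> [h1 h2] [h3 h4]; split.
- apply: (filter_imp_2 _ (is_pseries_mult_near h1 h3) (is_pseries_mult_near h2 h4)) => y.
  by move=> i1 i2; exact: (is_pseries_minus _ _ _ _ _ i1 i2).
- apply: (filter_imp_2 _ (is_pseries_mult_near h1 h4) (is_pseries_mult_near h2 h3)) => y.
  by move=> i1 i2; exact: (is_pseries_plus _ _ _ _ _ i1 i2).
Qed.

Lemma expands_as_at (x : R) (a : nat -> C) (F : R -> C) : expands_as x a F -> a 0%N = F x.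
Proof.
move=> [/locally_singleton h1 /locally_singleton h2].
move: h1 h2 => /is_pseries_unique; rewrite PSeries_at_0 => h1 /is_pseries_unique.
rewrite PSeries_at_0; rewrite /re_part /im_part in h1 *.
by case: (a 0%N) (F x) h1 => [p q] [r s] /= -> ->.
Qed.

Lemma expands_as_0 (x : R) : expands_as x (fun _ => RtoC 0) (fun _ => RtoC 0).
Proof.
have H : forall h, is_pseries (fun n : nat => 0) h 0.
  move=> h; apply/is_pseries_R; apply: (is_series_ext (fun _ => 0)) => [n|].
    by rewrite Rmult_0_l.
  by apply: filterlim_ext (filterlim_const 0) => n; rewrite sum_n_const Rmult_0_r.
by split; apply: filter_forall => y; exact: H.
Qed.

Lemma expands_as_nest_series (x : R) (as_ : seq (nat -> C)) (qs : seq (R -> C))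
    (a : nat -> C) (z : R -> C) :
  List.Forall2 (expands_as x) as_ qs -> expands_as x a z ->
    expands_as x (nest_series as_ a) (nest qs z).
Proof.
move=> h hz; elim: h => [|b q bs {}qs hq _ IH]; first exact: expands_as_0.
by rewrite nest_series_cons; apply: expands_as_plus => //; exact: expands_as_cauchy_product.
Qed.

Lemma expands_as_unique (x : R) (a : nat -> C) (F G : R -> C) :
  expands_as x a F -> expands_as x a G -> locally x (fun y => F y = G y).
Proof.
move=> [h1 h2] [h3 h4].
apply: (filter_imp_2 _ (filter_and _ _ h1 h2) (filter_and _ _ h3 h4)) => y.
move=> [/is_pseries_unique e1 /is_pseries_unique e2].
move=> [/is_pseries_unique e3 /is_pseries_unique e4].
move: e1 e2; rewrite e3 e4 /re_part /im_part.
by case: (F y) (G y) => [p q] [r s] /= -> ->.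
Qed.

Lemma expands_as_trunc_norm_bounded (x : R) (a : nat -> C) (F : R -> C) : expands_as x a F ->
  exists r M, [/\ 0 < r, 0 <= M & forall k, ctrunc_norm r a k <= M].
Proof.
move=> [/real_analytic_CV /trunc_norm_bounded [r [M [r0 M0 h]]] /real_analytic_CV
  /trunc_norm_bounded [s [N [s0 N0 h']]]].
exists (Rmin r s), (M + N); split; [exact: Rmin_glb_lt | lra | move=> k].
have t0 : 0 < Rmin r s by exact: Rmin_glb_lt.
apply: Rplus_le_compat.
- by apply: Rle_trans (h k); apply: trunc_norm_le; split; [lra | exact: Rmin_l].
- by apply: Rle_trans (h' k); apply: trunc_norm_le; split; [lra | exact: Rmin_r].
Qed.

Lemma expands_as_all_trunc_norm_bounded (x : R) (as_ : seq (nat -> C)) (qs : seq (R -> C)) :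
  List.Forall2 (expands_as x) as_ qs ->
  exists r M, [/\ 0 < r, 0 <= M &
    List.Forall (fun a => forall k, ctrunc_norm r a k <= M) as_].
Proof.
elim=> [|a q {}as_ {}qs /expands_as_trunc_norm_bounded [r [M [r0 M0 h]]] _ [s [N [s0 N0 hs]]]].
  by exists 1, 1; split; [lra | lra | exact: List.Forall_nil].
have t0 : 0 < Rmin r s by exact: Rmin_glb_lt.
exists (Rmin r s), (M + N); split=> //; first lra.
apply: List.Forall_cons => [k|].
  have : ctrunc_norm (Rmin r s) a k <= ctrunc_norm r a k.
    by apply: ctrunc_norm_le; split; [lra | exact: Rmin_l].
  have := h k; lra.
apply: List.Forall_impl hs => b hb k.
have : ctrunc_norm (Rmin r s) b k <= ctrunc_norm s b k.
  by apply: ctrunc_norm_le; split; [lra | exact: Rmin_r].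
have := hb k; lra.
Qed.

(** The formal solution of [z = q0 + z (q1 + z (...))] converges, and [z] is
    its sum: the difference of two solutions is multiplied by the divided
    difference of the right-hand side, which is small near [x]. *)
Theorem implicit_analytic_at (x : R) (q0 q1 : R -> C) (qs : seq (R -> C)) (z : R -> C) :
  List.Forall (fun q => analytic_at q x) [:: q0, q1 & qs] ->
  q0 x = RtoC 0 -> q1 x = RtoC 0 -> z x = RtoC 0 -> ccontinuous z x ->
  locally x (fun y => z y = nest [:: q0, q1 & qs] z y) -> analytic_at z x.
Proof.
move=> hq q00 q10 z0 cz ez.
have [as_ has] : exists as_, List.Forall2 (expands_as x) as_ [:: q0, q1 & qs].
  elim: hq => [|q l /analytic_at_expands [a ha] _ [l' h']]; first by exists [::].
  by exists (a :: l'); exact: List.Forall2_cons.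
have [r [M [r0 M0 hM]]] := expands_as_all_trunc_norm_bounded has.
have a00 : nth (fun _ => RtoC 0) as_ 0 0%N = RtoC 0.
  by inversion has as [|a q' l l' h _ e1 e2]; rewrite /= (expands_as_at h).
have a10 : nth (fun _ => RtoC 0) as_ 1 0%N = RtoC 0.
  inversion has as [|a q' l l' _ h e1 e2]; inversion h as [|a' q'' k k' h' _ e3 e4].
  by rewrite /= (expands_as_at h').
have {}as2 : exists a0 a1 as2, as_ = [:: a0, a1 & as2].
  inversion has as [|a q' l l' _ h e1 e2]; inversion h as [|a' q'' k k' h' _ e3 e4].
  by exists a, a', k.
case: as2 => a0 [a1 [as2 e]]; rewrite {as_}e /= in has hM a00 a10.
have [u [s [s0 hu u0 eu]]] := formal_implicit r0 M0 hM a00 a10.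
pose Z y : C := (PSeries (re_part u) (y - x), PSeries (im_part u) (y - x)).
have hZ : expands_as x u Z.
  split; apply: is_pseries_PSeries_near; apply: (CV_radius_trunc_norm s0 (M := 1)) => k;
  apply: Rle_trans (hu k); rewrite /ctrunc_norm;
  [have := trunc_norm_ge0 (im_part u) k (Rlt_le _ _ s0) | have :=
    trunc_norm_ge0 (re_part u) k (Rlt_le _ _ s0)];
  lra.
have canZ : analytic_at Z x by apply/analytic_at_expands; exists u.
have eZ : locally x (fun y => Z y = nest [:: q0, q1 & qs] Z y).
  by have h := expands_as_nest_series has hZ; rewrite -eu in h; exact: expands_as_unique hZ h.
have Z0 : Z x = RtoC 0 by rewrite -(expands_as_at hZ).
pose D := nest_diff [:: q0, q1 & qs] z Z.
have cq : List.Forall (fun q => ccontinuous q x) [:: q0, q1 & qs].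
  by apply: List.Forall_impl hq => q; exact: analytic_at_ccontinuous.
have cD : ccontinuous (fun y => (RtoC 1 - D y)%C) x.
  apply: ccontinuous_plus; first exact: ccontinuous_const.
  by apply: ccontinuous_opp; apply: ccontinuous_nest_diff => //; exact: analytic_at_ccontinuous.
have D1 : (RtoC 1 - D x)%C <> RtoC 0.
  rewrite /D /= q10 z0 Z0 => h; have : RtoC 1 = RtoC 0 by rewrite -h; ring.
  by move/RtoC_inj; lra.
apply: analytic_at_ext_loc canZ.
apply: (filter_imp_2 _ (ccontinuous_neq0 cD D1) (filter_and _ _ ez eZ)) => y hD [e1 e2].
have : ((z y - Z y) * (RtoC 1 - D y) = RtoC 0)%C.
  transitivity ((z y - Z y) - (z y - Z y) * D y)%C; first by ring.
  by rewrite -nest_minus -e1 -e2; ring.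
move=> h; have : (z y - Z y)%C = RtoC 0.
  by rewrite -[LHS]Cmult_1_r -(Cinv_r _ hD) Cmult_assoc h Cmult_0_l.
by move=> h'; rewrite -[RHS](Cplus_0_r) -(Cplus_0_l (Z y)) -{1}h'; ring.
Qed.

(** With v = 1 / F(x) and w = F - F(x), the function z = 1 / F - v satisfies
    z = - v v w - v w z, to which the implicit function theorem applies. *)
Lemma analytic_at_inv (F : R -> C) (x : R) :
  analytic_at F x -> F x <> RtoC 0 -> analytic_at (fun y => (/ F y)%C) x.
Proof.
move=> hF F0.
have nz := ccontinuous_neq0 (analytic_at_ccontinuous hF) F0.
pose v := (/ F x)%C; pose w y := (F y - F x)%C.
have hw : analytic_at w x by apply: analytic_at_minus => //; exact: analytic_at_const.
have w0 : w x = RtoC 0 by rewrite /w; ring.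
have H : analytic_at (fun y => (/ F y - v)%C) x.
  apply: (@implicit_analytic_at x (fun y => (- (v * v) * w y)%C) (fun y => (- v * w y)%C) [::]).
  - apply: List.Forall_cons; first by apply: analytic_at_mult => //; exact: analytic_at_const.
    apply: List.Forall_cons; last exact: List.Forall_nil.
    by apply: analytic_at_mult => //; exact: analytic_at_const.
  - by rewrite w0; ring.
  - by rewrite w0; ring.
  - by rewrite /v; ring.
  - apply: ccontinuous_plus; last exact: ccontinuous_const.
    by apply: ccontinuous_inv => //; exact: analytic_at_ccontinuous.
  - by apply: filter_imp nz => y hy /=; rewrite /v /w; field.
apply: analytic_at_ext_loc (analytic_at_plus H (analytic_at_const v x));
  apply: filter_forall => y; ring.
Qed.

Lemma real_analytic_inv (f : R -> R) (x : R) : real_analytic_at f x -> f x <> 0 ->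
  real_analytic_at (fun y => / f y) x.
Proof.
move=> hf f0; have [|h _] := analytic_at_inv (analytic_at_RtoC hf); first by move/RtoC_inj.
apply: real_analytic_ext_loc h;
  apply: filter_imp (continuous_neq0 (real_analytic_continuous hf) f0) => y hy.
by rewrite /re_part /Cinv /=; field.
Qed.

(** A continuous quotient of two analytic germs is analytic: the order of
    vanishing of the denominator cannot exceed that of the numerator. *)
Lemma real_analytic_div (f a b : R -> R) (x : R) :
  real_analytic_at a x -> real_analytic_at b x -> ~ locally x (fun y => b y = 0) ->
    continuous f x ->
  locally x (fun y => b y * f y = a y) -> real_analytic_at f x.
Proof.
move=> ha /real_analytic_order [h /(_ h) //|[n [g [hg g0 eb]]]] _ cf e.
have {eb}e : locally x (fun y => (y - x) ^ n * (g y * f y) = a y).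
  by apply: (filter_imp_2 _ e eb) => y <- ->; ring.
elim: n a ha e => [|n IH] a ha e.
  apply: real_analytic_ext_loc (real_analytic_mult ha (real_analytic_inv hg g0)).
  apply: (filter_imp_2 _ e (continuous_neq0 (real_analytic_continuous hg) g0)) => y <- hy.
  by field.
have a0 : a x = 0 by rewrite -(locally_singleton _ _ e) Rminus_diag /=; ring.
have [c hc ec] := real_analytic_factor ha a0.
apply: (IH c hc).
pose k y := (y - x) ^ n * (g y * f y) - c y.
have ck : continuous k x.
  apply: (continuous_minus (V := R_NormedModule) (fun y => (y - x) ^ n * (g y * f y)) c).
    apply: (continuous_mult (K := R_AbsRing) (fun y => (y - x) ^ n) (fun y => g y * f y)).
      by apply: (ex_derive_continuous (V := R_NormedModule)); auto_derive.
    by apply: (continuous_mult (K := R_AbsRing) g f) => //; exact: real_analytic_continuous.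
  exact: real_analytic_continuous.
have k0 : locally' x (fun y => k y = 0).
  apply: (filter_imp_2 _ e ec) => y e1 e2 ne; rewrite /k.
  apply: (Rmult_eq_reg_l (y - x)); last lra.
  by rewrite Rmult_0_r Rmult_minus_distr_l -e2 -e1 /=; ring.
by apply: filter_imp (continuous_punctured0 ck k0) => y; exact: Rminus_diag_uniq.
Qed.

(** * Coordinates in the plane *)

Lemma filterlim_C (T : Type) (F : (T -> Prop) -> Prop) {FF : Filter F}
    (f : T -> C) (l : C) :
  filterlim f F (locally (T := prod_UniformSpace R_UniformSpace R_UniformSpace) l) <->
  filterlim (re_part f) F (locally (fst l)) /\ filterlim (im_part f) F (locally (snd l)).
Proof.
split=> [/filterlim_locally h|[/filterlim_locally h1 /filterlim_locally h2]].
  by split; apply/filterlim_locally => e; apply: filter_imp (h e) => x [].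
by apply/filterlim_locally => e; apply: (filter_imp_2 _ (h1 e) (h2 e)).
Qed.

Lemma sum_n_re_part (a : nat -> C) (n : nat) :
  fst (sum_n (G := NormedModule.AbelianMonoid R_AbsRing C_R_NormedModule) a n)
  = sum_n (re_part a) n.
Proof. by elim: n => [|n IH]; rewrite ?sum_O // !sum_Sn -IH. Qed.

Lemma sum_n_im_part (a : nat -> C) (n : nat) :
  snd (sum_n (G := NormedModule.AbelianMonoid R_AbsRing C_R_NormedModule) a n)
  = sum_n (im_part a) n.
Proof. by elim: n => [|n IH]; rewrite ?sum_O // !sum_Sn -IH. Qed.

Lemma is_pseries_C (a : nat -> C) (h : R) (l : C) :
  is_pseries (V := C_R_NormedModule) a h l <->
  is_pseries (re_part a) h (fst l) /\ is_pseries (im_part a) h (snd l).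
Proof.
pose u k : C := scal (V := C_R_ModuleSpace) (pow_n (h : R_Ring) k) (a k).
have e1 : re_part (sum_n (G := NormedModule.AbelianMonoid R_AbsRing C_R_NormedModule) u)
    = sum_n (G := R_AbelianMonoid) (re_part u).
  by apply: functional_extensionality => n; exact: sum_n_re_part.
have e2 : im_part (sum_n (G := NormedModule.AbelianMonoid R_AbsRing C_R_NormedModule) u)
    = sum_n (G := R_AbelianMonoid) (im_part u).
  by apply: functional_extensionality => n; exact: sum_n_im_part.
have H := @filterlim_C nat eventually (@filter_filter nat eventually eventually_filter)
  (sum_n (G := NormedModule.AbelianMonoid R_AbsRing C_R_NormedModule) u) l.
rewrite e1 e2 in H; exact: H.
Qed.

Lemma analytic_onP (J : R -> Prop) (F : R -> C) :
  analytic_on J F <-> forall x, J x -> analytic_at F x.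
Proof.
split=> h x /h.
  case=> a ha; apply/analytic_at_expands; exists a.
  by split; apply: filter_imp ha => y /is_pseries_C [].
move/analytic_at_expands=> [a [h1 h2]]; exists a; apply: (filter_imp_2 _ h1 h2) => y i1 i2.
exact/is_pseries_C.
Qed.

Definition is_cderive (F : R -> C) (x : R) (l : C) : Prop :=
  is_derive (re_part F) x (fst l) /\ is_derive (im_part F) x (snd l).

Lemma is_derive_C (F : R -> C) (x : R) (l : C) :
  is_derive (V := C_R_NormedModule) F x l <-> is_cderive F x l.
Proof.
split=> [h|[h1 h2]].
- split.
  + apply: (filterdiff_ext_lin _ _ _ (filterdiff_comp' F (fun z : C => fst z) x _ _ h
      (filterdiff_linear _ is_linear_fst))) => y; by [].
  + apply: (filterdiff_ext_lin _ _ _ (filterdiff_comp' F (fun z : C => snd z) x _ _ h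
      (filterdiff_linear _ is_linear_snd))) => y; by [].
- have d1 := is_derive_scal_l (V := C_R_NormedModule) _ _ _ (1, 0) h1.
  have d2 := is_derive_scal_l (V := C_R_NormedModule) _ _ _ (0, 1) h2.
  have := is_derive_plus (V := C_R_NormedModule) _ _ _ _ _ d1 d2.
  have E (p q : R) : plus (G := NormedModule.AbelianMonoid R_AbsRing C_R_NormedModule)
      (scal (V := NormedModule.ModuleSpace R_AbsRing C_R_NormedModule) (p : R_AbsRing) (1, 0))
      (scal (V := NormedModule.ModuleSpace R_AbsRing C_R_NormedModule) (q :
        R_AbsRing) (0, 1)) = (p, q).
    rewrite /plus /scal /= /prod_plus /prod_scal /plus /scal /= /mult /=.
    by congr pair; ring.
  rewrite E -surjective_pairing.
  by apply: is_derive_ext => t; rewrite E /re_part /im_part -surjective_pairing.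
Qed.

Lemma cderive_Dx (F : R -> C) (x : R) (l : C) : is_cderive F x l -> Dx F x = l.
Proof.
move=> [/is_derive_unique h1 /is_derive_unique h2].
by rewrite [l]surjective_pairing -h1 -h2.
Qed.

Lemma cderive_ext_loc (F G : R -> C) (x : R) (l : C) :
  locally x (fun y => F y = G y) -> is_cderive F x l -> is_cderive G x l.
Proof.
move=> e [h1 h2]; split; [apply: is_derive_ext_loc h1 | apply: is_derive_ext_loc h2];
by apply: filter_imp e => y; rewrite /re_part /im_part => ->.
Qed.

Lemma Dx_ext_loc (F G : R -> C) (x : R) :
  locally x (fun y => F y = G y) -> Dx F x = Dx G x.
Proof.
by move=> e; congr pair; apply: Derive_ext_loc; apply: filter_imp e => y ->.
Qed.

Lemma cderive_const (c : C) (x : R) : is_cderive (fun _ => c) x (RtoC 0).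
Proof. by split; exact: is_derive_const. Qed.

Lemma cderive_plus (F G : R -> C) (x : R) (l m : C) :
  is_cderive F x l -> is_cderive G x m -> is_cderive (fun y => (F y + G y)%C) x (l + m)%C.
Proof.
move=> [h1 h2] [h3 h4]; split.
- exact: (is_derive_plus (V := R_NormedModule) (re_part F) (re_part G)).
- exact: (is_derive_plus (V := R_NormedModule) (im_part F) (im_part G)).
Qed.

Lemma cderive_opp (F : R -> C) (x : R) (l : C) :
  is_cderive F x l -> is_cderive (fun y => (- F y)%C) x (- l)%C.
Proof.
move=> [h1 h2]; split.
- exact: (is_derive_opp (V := R_NormedModule) (re_part F)).
- exact: (is_derive_opp (V := R_NormedModule) (im_part F)).
Qed.

Lemma cderive_mult (F G : R -> C) (x : R) (l m : C) :
  is_cderive F x l -> is_cderive G x m ->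
  is_cderive (fun y => (F y * G y)%C) x (l * G x + F x * m)%C.
Proof.
move=> [h1 h2] [h3 h4]; split.
- apply: (is_derive_ext (fun y => re_part F y * re_part G y - im_part F y * im_part G y)) => //.
  auto_derive; first by do !split; eexists; eassumption.
  rewrite (is_derive_unique _ _ _ h1) (is_derive_unique _ _ _ h2).
  rewrite (is_derive_unique _ _ _ h3) (is_derive_unique _ _ _ h4) /re_part /im_part /=; ring.
- apply: (is_derive_ext (fun y => re_part F y * im_part G y + im_part F y * re_part G y)) => //.
  auto_derive; first by do !split; eexists; eassumption.
  rewrite (is_derive_unique _ _ _ h1) (is_derive_unique _ _ _ h2).
  rewrite (is_derive_unique _ _ _ h3) (is_derive_unique _ _ _ h4) /re_part /im_part /=; ring.
Qed.

Lemma cderive_scal (c : C) (F : R -> C) (x : R) (l : C) :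
  is_cderive F x l -> is_cderive (fun y => (c * F y)%C) x (c * l)%C.
Proof.
move=> h; have := cderive_mult (cderive_const c x) h.
by rewrite Cmult_0_l Cplus_0_l.
Qed.

Lemma analytic_at_cderive (F : R -> C) (x : R) : analytic_at F x -> is_cderive F x (Dx F x).
Proof. by move=> [h1 h2]; split; apply: Derive_correct; exact: real_analytic_ex_derive. Qed.

Lemma cderive_ccontinuous (F : R -> C) (x : R) (l : C) : is_cderive F x l -> ccontinuous F x.
Proof.
by move=> [h1 h2]; split; apply: (ex_derive_continuous (V := R_NormedModule)); eexists;
  eassumption.
Qed.

Lemma analytic_smooth (J : R -> Prop) (F : R -> C) : analytic_on J F -> smooth_on J F.
Proof.
move/analytic_onP => h n x Jx.
have /analytic_at_cderive/is_derive_C hn : analytic_at (Dn n F) x.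
  by elim: n => [|n IH]; [exact: h | exact: analytic_at_Dx].
by eexists; eassumption.
Qed.

Lemma smooth_cderive (J : R -> Prop) (F : R -> C) (n : nat) (x : R) :
  smooth_on J F -> J x -> is_cderive (Dn n F) x (Dn n.+1 F x).
Proof.
move=> h Jx; have [l /is_derive_C hl] := h n x Jx.
by rewrite /Dn /= -/(Dn n F) (cderive_Dx hl).
Qed.

Lemma smooth_ccontinuous (J : R -> Prop) (F : R -> C) (x : R) :
  smooth_on J F -> J x -> ccontinuous F x.
Proof. by move=> h Jx; apply: (cderive_ccontinuous (smooth_cderive 0 h Jx)). Qed.

Lemma analytic_at_primitive (F f : R -> C) (x : R) :
  locally x (fun y => is_cderive F y (f y)) -> analytic_at f x -> analytic_at F x.
Proof.
move=> h [h1 h2]; split; [apply: real_analytic_primitive h1 | apply: real_analytic_primitive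
  h2];
by apply: filter_imp h => y [].
Qed.

Lemma ccontinuous_punctured0 (F : R -> C) (x : R) :
  ccontinuous F x -> locally' x (fun y => F y = RtoC 0) -> locally x (fun y => F y = RtoC 0).
Proof.
move=> [c1 c2] h.
have h1 : locally' x (fun y => re_part F y = 0).
  by apply: filter_imp h => y; rewrite /re_part => ->.
have h2 : locally' x (fun y => im_part F y = 0).
  by apply: filter_imp h => y; rewrite /im_part => ->.
apply: (filter_imp_2 _ (continuous_punctured0 c1 h1) (continuous_punctured0 c2 h2)) => y.
exact: C_eq0.
Qed.

Lemma analytic_at_isolated (F : R -> C) (x : R) : analytic_at F x ->
  locally x (fun y => F y = RtoC 0) \/ locally' x (fun y => F y <> RtoC 0).
Proof.
move=> [/real_analytic_isolated h1 /real_analytic_isolated h2].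
case: h1 => h1; last first.
  by right; apply: filter_imp h1 => y h e; apply: h; rewrite /re_part e.
case: h2 => h2; last first.
  by right; apply: filter_imp h2 => y h e; apply: h; rewrite /im_part e.
by left; apply: (filter_imp_2 _ h1 h2) => y; exact: C_eq0.
Qed.

(** Multiplying by the conjugate of [b] reduces to a real denominator. *)
Lemma analytic_at_div (F a b : R -> C) (x : R) :
  analytic_at a x -> analytic_at b x -> ~ locally x (fun y => b y = RtoC 0) ->
    ccontinuous F x ->
  locally x (fun y => (b y * F y)%C = a y) -> analytic_at F x.
Proof.
move=> [a1 a2] [b1 b2] nb [c1 c2] e.
pose d y := re_part b y * re_part b y + im_part b y * im_part b y.
have hd : real_analytic_at d x by apply: real_analytic_plus; exact: real_analytic_mult.
have nd : ~ locally x (fun y => d y = 0).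
  move=> h; apply: nb; apply: filter_imp h => y; rewrite /d /re_part /im_part => h.
  exact: C_normsq_eq0.
split.
- apply: (real_analytic_div (a :=
  fun y => re_part b y * re_part a y + im_part b y * im_part a y) _ hd nd c1).
    by apply: real_analytic_plus; exact: real_analytic_mult.
  by apply: filter_imp e => y; rewrite /d /re_part /im_part => <- /=; ring.
- apply: (real_analytic_div (a :=
  fun y => re_part b y * im_part a y + - (im_part b y * re_part a y)) _ hd nd c2).
    by apply: real_analytic_plus; [|apply: real_analytic_opp]; exact: real_analytic_mult.
  by apply: filter_imp e => y; rewrite /d /re_part /im_part => <- /=; ring.
Qed.

(** * Analytic functions on an open interval *)

Definition open_interval (J : R -> Prop) : Prop :=
  [/\ exists x, J x, forall x, J x -> locally x J
    & forall x y t, J x -> J y -> x <= t <= y -> J t].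

Lemma ointerval_open_interval (a b : Rbar) : Rbar_lt a b -> open_interval (ointerval a b).
Proof.
move=> ab; split.
- case: a b ab => [a||] [b||] //= ab.
  + by exists ((a + b) / 2); rewrite /ointerval /=; lra.
  + by exists (a + 1); rewrite /ointerval /=; lra.
  + by exists (b - 1); rewrite /ointerval /=; lra.
  + by exists 0.
- move=> x [h1 h2]; apply: filter_and.
    by apply: (open_Rbar_gt' x a).
  by apply: (open_Rbar_lt' x b).
- move=> x y t [h1 _] [_ h2] [h3 h4]; split.
    exact: (Rbar_lt_le_trans a x t h1 h3).
  exact: (Rbar_le_lt_trans t y b h4 h2).
Qed.

Section Interval.

Variable J : R -> Prop.
Hypothesis hJ : open_interval J.

Lemma open_interval_open (x : R) : J x -> locally x J.
Proof. by case: hJ => _ h _; exact: h. Qed.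

Lemma open_interval_between (x y t : R) : J x -> J y -> Rmin x y <= t <= Rmax x y -> J t.
Proof.
case: hJ => _ _ h Jx Jy; rewrite /Rmin /Rmax; case: Rle_dec => _ tb.
- exact: (h x y).
- exact: (h y x).
Qed.

Lemma is_derive_0_const (f : R -> R) : (forall x, J x -> is_derive f x 0) ->
  forall x y, J x -> J y -> f x = f y.
Proof.
move=> h x y Jx Jy; case: (Rtotal_order x y) => [lt|[->//|lt]].
- apply: (eq_is_derive (V := R_NormedModule)) => // t tb; apply: h.
  by case: hJ => _ _ hc; apply: (hc x y).
- symmetry; apply: (eq_is_derive (V := R_NormedModule)) => // t tb; apply: h.
  by case: hJ => _ _ hc; apply: (hc y x).
Qed.

Lemma cderive_0_const (F : R -> C) : (forall x, J x -> is_cderive F x (RtoC 0)) ->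
  forall x y, J x -> J y -> F x = F y.
Proof.
move=> h x y Jx Jy; rewrite [LHS]surjective_pairing [RHS]surjective_pairing.
congr pair.
- by apply: (is_derive_0_const (f := re_part F)) => // t /h [].
- by apply: (is_derive_0_const (f := im_part F)) => // t /h [].
Qed.

Lemma cderive_eq (F G f : R -> C) (x0 : R) :
  (forall x, J x -> is_cderive F x (f x)) -> (forall x, J x -> is_cderive G x (f x)) ->
  J x0 -> F x0 = G x0 -> forall x, J x -> F x = G x.
Proof.
move=> hF hG J0 e0 x Jx.
have : (F x - G x = F x0 - G x0)%C.
  apply: (cderive_0_const (F := fun y => (F y - G y)%C)) => // y Jy.
  have -> : RtoC 0 = (f y - f y)%C by ring.
  by apply: cderive_plus; [exact: hF | apply: cderive_opp; exact: hG].
rewrite e0 => h; have -> : F x = (F x - G x + G x)%C by ring.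
by rewrite h; ring.
Qed.

(** A locally constant property is constant: its indicator has derivative 0. *)
Lemma locally_constant (Q : R -> Prop) :
  (forall x, J x -> locally x (fun y => Q y <-> Q x)) ->
  forall x y, J x -> J y -> Q x -> Q y.
Proof.
move=> h x y Jx Jy Qx.
pose f z := if excluded_middle_informative (Q z) then 1 else 0.
have : f x = f y.
  apply: is_derive_0_const => // z Jz.
  apply: (is_derive_ext_loc (fun _ => f z)); last exact: is_derive_const.
  apply: filter_imp (h z Jz) => t tb; rewrite /f.
  by case: excluded_middle_informative => q1; case: excluded_middle_informative => q2 //=;
    tauto.
rewrite /f; case: excluded_middle_informative => //= q1.
by case: excluded_middle_informative => //= q2 ?; lra.
Qed.

(** Being locally zero is a locally constant property, since a zero of a
    nonzero germ is isolated. *)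
Lemma identity_theorem (F : R -> C) (x : R) : analytic_on J F -> J x ->
  ~ locally x (fun y => F y = RtoC 0) ->
  forall y, J y -> locally' y (fun z => F z <> RtoC 0).
Proof.
move=> /analytic_onP hF Jx nx y Jy; case: (analytic_at_isolated (hF y Jy)) => // h.
case: nx; move: h; apply: (locally_constant (Q := fun y => locally y _)) => // z Jz.
case: (analytic_at_isolated (hF z Jz)) => hz.
  by apply: filter_imp (locally_locally _ _ hz).
have nz : ~ locally z (fun y => F y = RtoC 0).
  move=> h; have /locally_ex_neq [t ne [h1 h2]] :
    locally z (fun y => F y = RtoC 0 /\ (y <> z -> F y <> RtoC 0)).
    exact: filter_and h hz.
  exact: h2.
apply: (filter_imp _ _ _ (hz : locally z (fun y => y <> z -> F y <> RtoC 0))) => t tb.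
case: (Req_dec t z) => [->//|ne]; split=> // /locally_singleton h.
by case: (tb ne).
Qed.

Lemma nonzero_near (b : R -> C) : analytic_on J b -> nonzero_on J b ->
  forall y, J y -> locally' y (fun z => b z <> RtoC 0).
Proof.
move=> hb [x Jx bx]; apply: identity_theorem hb Jx _.
by move/locally_singleton.
Qed.

Section Integral.

Variables (f : R -> C) (x0 : R).
Hypothesis (hf : forall x, J x -> ccontinuous f x) (J0 : J x0).

Lemma CInt_cderive (x : R) : J x -> is_cderive (CInt f x0) x (f x).
Proof.
move=> Jx; apply/is_derive_C.
have cf y : J y -> continuous (f : R -> C_R_CompleteNormedModule) y.
  move=> /hf h; exact/(filterlim_C (FF := filter_filter)).
apply: (is_derive_RInt (V := C_R_NormedModule) f (CInt f x0) x0 x); last exact: cf.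
apply: filter_imp (open_interval_open Jx) => y Jy.
apply: (RInt_correct (V := C_R_CompleteNormedModule)).
apply: (ex_RInt_continuous (V := C_R_CompleteNormedModule)) => z hz.
by apply: cf; exact: (open_interval_between J0 Jy).
Qed.

Lemma CInt_at : CInt f x0 x0 = RtoC 0.
Proof. exact: (RInt_point (V := C_R_CompleteNormedModule) x0 f). Qed.

Lemma CInt_unique (F : R -> C) : (forall x, J x -> is_cderive F x (f x)) ->
  forall x, J x -> CInt f x0 x = (F x - F x0)%C.
Proof.
move=> hF; apply: (cderive_eq (f := f)) J0 _; first exact: CInt_cderive.
- move=> x Jx; have -> : f x = (f x + RtoC 0)%C by ring.
  by apply: cderive_plus; [exact: hF | exact: cderive_const].
- by rewrite CInt_at; ring.
Qed.

End Integral.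

(** Continuity excludes poles. *)
Lemma continuous_quotient_analytic (F : R -> C) :
  quotient_of_analytic J F -> (forall x, J x -> ccontinuous F x) -> analytic_on J F.
Proof.
move=> [a [b [/analytic_onP ha hb nb e]]] cF; apply/analytic_onP => x Jx.
have bn := nonzero_near hb nb Jx; move/analytic_onP in hb.
apply: (analytic_at_div (ha x Jx) (hb x Jx)) (cF x Jx) _.
  move=> h; have /locally_ex_neq [t ne [h1 h2]] :
    locally x (fun y => b y = RtoC 0 /\ (y <> x -> b y <> RtoC 0)).
    exact: filter_and h bn.
  exact: h2.
have ck : ccontinuous (fun y => (b y * F y - a y)%C) x.
  apply: ccontinuous_plus; first by apply: ccontinuous_mult; [apply: analytic_at_ccontinuous;
    exact: hb | exact: cF].
  by apply: ccontinuous_opp; apply: analytic_at_ccontinuous; exact: ha.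
suff : locally x (fun y => (b y * F y - a y)%C = RtoC 0).
  apply: filter_imp => y h; have -> : (b y * F y = b y * F y - a y + a y)%C by ring.
  by rewrite h; ring.
apply: ccontinuous_punctured0 ck _.
apply: (filter_imp_2 _ (open_interval_open Jx) (bn : locally x (fun z => z <> x ->
  b z <> RtoC 0))).
by move=> y Jy h /h by0; rewrite (e y Jy by0); field.
Qed.

End Interval.

(** * Generic points *)

(** [same J F G] is, by definition, [generically J (fun x => F x = G x)]. *)
Definition generically (J P : R -> Prop) : Prop :=
  exists b, [/\ analytic_on J b, nonzero_on J b
    & forall x, J x -> b x <> RtoC 0 -> P x].

Lemma analytic_const (J : R -> Prop) (c : C) : analytic_on J (fun _ => c).
Proof. by apply/analytic_onP => x _; exact: analytic_at_const. Qed.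

Lemma analytic_mult (J : R -> Prop) (F G : R -> C) :
  analytic_on J F -> analytic_on J G -> analytic_on J (fun x => (F x * G x)%C).
Proof.
move=> /analytic_onP hF /analytic_onP hG; apply/analytic_onP => x Jx.
by apply: analytic_at_mult; [exact: hF | exact: hG].
Qed.

Lemma analytic_plus (J : R -> Prop) (F G : R -> C) :
  analytic_on J F -> analytic_on J G -> analytic_on J (fun x => (F x + G x)%C).
Proof.
move=> /analytic_onP hF /analytic_onP hG; apply/analytic_onP => x Jx.
by apply: analytic_at_plus; [exact: hF | exact: hG].
Qed.

Lemma analytic_Dx (J : R -> Prop) (F : R -> C) : analytic_on J F -> analytic_on J (Dx F).
Proof. by move=> /analytic_onP hF; apply/analytic_onP => x /hF; exact: analytic_at_Dx. Qed.

Lemma Cmult_neq0_inv (z w : C) : (z * w)%C <> RtoC 0 -> z <> RtoC 0 /\ w <> RtoC 0.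
Proof. by move=> h; split=> e; apply: h; rewrite e; ring. Qed.

Lemma C1_neq0 : RtoC 1 <> RtoC 0.
Proof. by move/RtoC_inj; lra. Qed.

Section Generic.

Variable J : R -> Prop.
Hypothesis hJ : open_interval J.

Lemma generically_all (P : R -> Prop) : (forall x, J x -> P x) -> generically J P.
Proof.
move=> h; exists (fun _ => RtoC 1); split; [exact: analytic_const | | by move=> x Jx _;
  exact: h].
have [[x Jx] _ _] := hJ; exists x => //; exact: C1_neq0.
Qed.

Lemma generically_imp (P Q : R -> Prop) : (forall x, J x -> P x -> Q x) -> generically J P ->
  generically J Q.
Proof. by move=> h [b [hb nb hP]]; exists b; split=> // x Jx bx; apply: h => //; exact: hP. Qed.

Lemma generically_and (P Q : R -> Prop) : generically J P -> generically J Q ->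
  generically J (fun x => P x /\ Q x).
Proof.
move=> [b [hb nb hP]] [c [hc nc hQ]].
exists (fun x => (b x * c x)%C); split; first exact: analytic_mult.
- have [[x Jx] _ _] := hJ.
  have /locally_ex_neq [y ne [Jy [h1 h2]]] : locally x (fun y => J y /\
      ((y <> x -> b y <> RtoC 0) /\ (y <> x -> c y <> RtoC 0))).
    apply: filter_and (open_interval_open hJ Jx) (filter_and _ _ _ _).
      exact: (nonzero_near hJ hb nb Jx).
    exact: (nonzero_near hJ hc nc Jx).
  by exists y => //; apply: Cmult_neq_0; [exact: h1 | exact: h2].
- by move=> x Jx /Cmult_neq0_inv [h1 h2]; split; [exact: hP | exact: hQ].
Qed.

Lemma generically_imp_2 (P Q S : R -> Prop) : (forall x, J x -> P x -> Q x -> S x) ->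
  generically J P -> generically J Q -> generically J S.
Proof.
move=> h hP hQ; apply: generically_imp (generically_and hP hQ) => x Jx []; exact: h.
Qed.

Lemma generically_and_n (P : nat -> R -> Prop) (n : nat) : (forall i, generically J (P i)) ->
  generically J (fun x => forall i, (i <= n)%N -> P i x).
Proof.
move=> h; elim: n => [|n IH].
  by apply: generically_imp (h 0%N) => x _ p i; rewrite leqn0 => /eqP ->.
apply: generically_imp_2 IH (h n.+1) => x _ p q i; rewrite leq_eqVlt => /orP [/eqP -> //|].
by rewrite ltnS; exact: p.
Qed.

Lemma generically_ex (P : R -> Prop) : generically J P -> exists2 x, J x & P x.
Proof. by move=> [b [_ [x Jx bx] h]]; exists x => //; exact: h. Qed.

Lemma generically_locally (P : R -> Prop) : generically J P ->
  generically J (fun x => locally x P).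
Proof.
move=> [b [hb nb hP]]; exists b; split=> // x Jx bx.
move/analytic_onP: hb => hb.
by apply: (filter_imp_2 _ (open_interval_open hJ Jx) (ccontinuous_neq0
  (analytic_at_ccontinuous (hb x Jx)) bx)).
Qed.

Lemma same_refl (F : R -> C) : same J F F.
Proof. exact: generically_all. Qed.

Lemma same_sym (F G : R -> C) : same J F G -> same J G F.
Proof. exact: generically_imp. Qed.

Lemma same_Dx (F G : R -> C) : same J F G -> same J (Dx F) (Dx G).
Proof. by move/generically_locally; apply: generically_imp => x _; exact: Dx_ext_loc. Qed.

(** * Quotients of analytic functions *)

Notation quotient := (quotient_of_analytic J).

Lemma quotient_analytic (F : R -> C) : analytic_on J F -> quotient F.
Proof.
move=> hF; exists F, (fun _ => RtoC 1); split=> //; first exact: analytic_const.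
- have [[x Jx] _ _] := hJ; exists x => //; exact: C1_neq0.
- by move=> x Jx _; field; exact: C1_neq0.
Qed.

(** The generic form of the definition, in which numerator and denominator can
    be built without tracking the exceptional points. *)
Lemma quotient_generically (F a b : R -> C) : analytic_on J a -> analytic_on J b ->
  generically J (fun x => b x <> RtoC 0 /\ F x = (a x / b x)%C) -> quotient F.
Proof.
move=> ha hb [c [hc nc h]].
exists (fun x => (a x * c x)%C), (fun x => (b x * c x)%C); split; try exact: analytic_mult.
- have [x Jx cx] := nc; exists x => //; apply: Cmult_neq_0 => //.
  by case: (h x Jx cx).
- move=> x Jx /Cmult_neq0_inv [bx cx]; have [_ ->] := h x Jx cx.
  by field; split.
Qed.

Lemma quotient_generically_quotient (F : R -> C) : quotient F ->
  exists a b, [/\ analytic_on J a, analytic_on J b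
  & generically J (fun x => b x <> RtoC 0 /\ F x = (a x / b x)%C)].
Proof.
move=> [a [b [ha hb nb h]]]; exists a, b; split=> //; exists b; split=> // x Jx bx.
by split=> //; exact: h.
Qed.

Lemma quotient_same (F G : R -> C) : quotient F -> same J F G -> quotient G.
Proof.
move=> /quotient_generically_quotient [a [b [ha hb h]]] e; apply: (quotient_generically ha hb).
by apply: generically_imp_2 h e => x _ [h1 h2] <-.
Qed.

Lemma quotient_plus (F G : R -> C) : quotient F -> quotient G ->
  quotient (fun x => (F x + G x)%C).
Proof.
move=> /quotient_generically_quotient [a [b [ha hb h]]] /quotient_generically_quotient [c [d
  [hc hd h']]].
apply: (quotient_generically (a := fun x => (a x * d x + c x * b x)%C) (b :=
  fun x => (b x * d x)%C)).
- by apply: analytic_plus; exact: analytic_mult.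
- exact: analytic_mult.
- apply: generically_imp_2 h h' => x _ [n1 ->] [n2 ->]; split; first exact: Cmult_neq_0.
  by field; split.
Qed.

Lemma quotient_mult (F G : R -> C) : quotient F -> quotient G ->
  quotient (fun x => (F x * G x)%C).
Proof.
move=> /quotient_generically_quotient [a [b [ha hb h]]] /quotient_generically_quotient [c [d
  [hc hd h']]].
apply: (quotient_generically (a := fun x => (a x * c x)%C) (b := fun x => (b x * d x)%C));
  try exact: analytic_mult.
apply: generically_imp_2 h h' => x _ [n1 ->] [n2 ->]; split; first exact: Cmult_neq_0.
by field; split.
Qed.

Lemma quotient_opp (F : R -> C) : quotient F -> quotient (fun x => (- F x)%C).
Proof.
move=> hF; have h := quotient_mult (quotient_analytic (analytic_const (J :=
  J) (- RtoC 1)%C)) hF.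
apply: (quotient_same h).
by apply: generically_all => x _; ring.
Qed.

(** A quotient which is not the zero element has a nonzero numerator. *)
Lemma generically_neq0 (F : R -> C) : quotient F -> ~ same J F zero_fun ->
  generically J (fun x => F x <> RtoC 0).
Proof.
move=> [a [b [ha hb nb h]]] nF.
have gb : generically J (fun x => b x <> RtoC 0) by exists b.
have ga : generically J (fun x => a x <> RtoC 0).
  exists a; split=> //; apply: NNPP => na; apply: nF; exists b; split=> // x Jx bx.
  rewrite (h x Jx bx) (_ : a x = RtoC 0); first by rewrite /zero_fun; field.
  by apply: NNPP => ax; apply: na; exists x.
apply: generically_imp_2 ga gb => x Jx ax bx; rewrite (h x Jx bx).
move=> e; apply: ax; have -> : a x = (a x / b x * b x)%C by field.
by rewrite e Cmult_0_l.
Qed.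

Lemma generically_neq0_not_same (F : R -> C) : generically J (fun x => F x <> RtoC 0) ->
  ~ same J F zero_fun.
Proof. by move=> h h'; have [x _ []] := generically_ex (generically_and h h'). Qed.

Lemma quotient_inv (F : R -> C) : quotient F -> ~ same J F zero_fun ->
  quotient (fun x => (/ F x)%C).
Proof.
move=> hF /(generically_neq0 hF) nF; have [a [b [ha hb h]]] := quotient_generically_quotient hF.
apply: (quotient_generically hb ha); apply: generically_imp_2 nF h => x _ n [bx e].
have ax : a x <> RtoC 0 by move=> ax; apply: n; rewrite e ax; field.
by split=> //; rewrite e; field; split.
Qed.

Lemma quotient_analytic_at (F : R -> C) : quotient F -> generically J (analytic_at F).
Proof.
move=> /quotient_generically_quotient [a [b [/analytic_onP ha /analytic_onP hb h]]].
apply: generically_imp_2 h (generically_locally h) => x Jx [bx _] e.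
apply: (analytic_at_ext_loc (F := fun x => (a x / b x)%C)).
  by apply: filter_imp e => y [_ ->].
by apply: analytic_at_mult; [exact: ha | apply: analytic_at_inv => //; exact: hb].
Qed.

End Generic.

Lemma generically_restrict (I J P : R -> Prop) : open_interval I -> open_interval J ->
  (forall x, J x -> I x) -> generically I P -> generically J P.
Proof.
move=> hI hJ sub [b [hb nb h]]; exists b; split.
- by move=> x /sub; exact: hb.
- have [[x Jx] op _] := hJ.
  have /locally_ex_neq [y ne [Jy h1]] : locally x (fun y => J y /\ (y <> x -> b y <> RtoC 0)).
    by apply: filter_and (op x Jx) _; exact: (nonzero_near hI hb nb (sub x Jx)).
  by exists y => //; exact: h1.
- by move=> x /sub; exact: h.
Qed.

Lemma quotient_restrict (I J : R -> Prop) (F : R -> C) : open_interval I -> open_interval J ->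
  (forall x, J x -> I x) -> quotient_of_analytic I F -> quotient_of_analytic J F.
Proof.
move=> hI hJ sub /(quotient_generically_quotient) [a [b [ha hb h]]];
  apply: (quotient_generically (a := a) (b := b)).
- by move=> x /sub; exact: ha.
- by move=> x /sub; exact: hb.
- exact: generically_restrict h.
Qed.

(** * Fields of functions *)

(** A subfield, containing the constants, of the field of quotients of analytic
    functions on [J]. *)
Record is_field (J : R -> Prop) (K : (R -> C) -> Prop) : Prop := IsField {
  field_quotient : forall F, K F -> quotient_of_analytic J F;
  field_const : forall c, K (fun _ => c);
  field_plus : forall F G, K F -> K G -> K (fun x => (F x + G x)%C);
  field_opp : forall F, K F -> K (fun x => (- F x)%C);
  field_mult : forall F G, K F -> K G -> K (fun x => (F x * G x)%C);
  field_inv : forall F, K F -> ~ same J F zero_fun -> K (fun x => (/ F x)%C);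
  field_same : forall F G, K F -> same J F G -> K G }.

Lemma adjoin_quotient (J : R -> Prop) (K : (R -> C) -> Prop) (g : R -> C) : open_interval J ->
  (forall F, K F -> quotient_of_analytic J F) -> quotient_of_analytic J g ->
  forall F, adjoin J K g F -> quotient_of_analytic J F.
Proof.
move=> hJ hK hg F; elim=> {F}.
- exact: hK.
- exact: hg.
- by move=> F G _ hF _ hG; exact: quotient_plus.
- by move=> F _ hF; exact: quotient_opp.
- by move=> F G _ hF _ hG; exact: quotient_mult.
- by move=> F _ hF; exact: quotient_inv.
- by move=> F G _ hF; exact: quotient_same.
Qed.

Lemma adjoin_field (J : R -> Prop) (K : (R -> C) -> Prop) (g : R -> C) : open_interval J ->
  (forall F, K F -> quotient_of_analytic J F) -> (forall c, K (fun _ => c)) ->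
  quotient_of_analytic J g -> is_field J (adjoin J K g).
Proof.
move=> hJ hK hc hg; split.
- exact: adjoin_quotient.
- by move=> c; apply: adjoin_base; exact: hc.
- exact: adjoin_add.
- exact: adjoin_opp.
- exact: adjoin_mul.
- exact: adjoin_inv.
- exact: adjoin_same.
Qed.

Lemma analytic_RtoC (J : R -> Prop) : analytic_on J RtoC.
Proof. by apply/analytic_onP => x _; apply: analytic_at_RtoC; exact: real_analytic_id. Qed.

Lemma constants_quotient (J : R -> Prop) : open_interval J ->
  forall F, constants J F -> quotient_of_analytic J F.
Proof.
move=> hJ F [c e]; apply: (quotient_same hJ (quotient_analytic hJ (analytic_const (J := J) c))).
exact: same_sym.
Qed.

Lemma elementary_is_field (J : R -> Prop) (K : (R -> C) -> Prop) : open_interval J ->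
  elementary_field J K -> is_field J K.
Proof.
move=> hJ; elim=> {K} [|K g _ hK hg _].
- apply: adjoin_field => //; first exact: constants_quotient.
  + by move=> c; exists c; exact: same_refl.
  + by apply: quotient_analytic => //; exact: analytic_RtoC.
- apply: adjoin_field => //; [exact: (field_quotient hK) | exact: (field_const hK)].
Qed.

(** * Minimal polynomials *)

Lemma csum_0 (F : nat -> C) : (sum_n F 0 : C) = F 0%N.
Proof. exact: sum_O. Qed.

Lemma csum_S (F : nat -> C) (n : nat) : (sum_n F n.+1 : C) = (sum_n F n + F n.+1)%C.
Proof. exact: sum_Sn. Qed.

Lemma csum_ext (F G : nat -> C) (n : nat) :
  (forall i, (i <= n)%N -> F i = G i) -> (sum_n F n : C) = sum_n G n.
Proof. by move=> h; apply: sum_n_ext_loc => i /leP; exact: h. Qed.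

Lemma csum_single (F : nat -> C) (m k : nat) : (m <= k)%N ->
  (forall i, (i <= k)%N -> i <> m -> F i = RtoC 0) -> (sum_n F k : C) = F m.
Proof.
elim: k => [|k IH]; first by rewrite leqn0 => /eqP ->; rewrite csum_0.
rewrite csum_S leq_eqVlt => /orP [/eqP -> |lt] h; last first.
  rewrite IH //; last by move=> i hi; apply: h; lia.
  by rewrite (h k.+1) ?Cplus_0_r //; lia.
rewrite (csum_ext (G := fun _ => RtoC 0)); last by move=> i hi; apply: h; lia.
have -> : forall j, (sum_n (fun _ : nat => RtoC 0) j : C) = RtoC 0.
  by elim=> [|j IHj]; rewrite ?csum_0 // csum_S IHj Cplus_0_l.
by rewrite Cplus_0_l.
Qed.

Definition poly_eval (n : nat) (a : nat -> R -> C) (g : R -> C) : R -> C :=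
  fun x => sum_n (fun i => (a i x * Cpow (g x) i)%C) n.

Section Cauchy.
Import GRing.Theory.

Lemma Ri_of_C_D (z w : C) : Ri_of_C (z + w)%C = (Ri_of_C z + Ri_of_C w)%R.
Proof. by []. Qed.

Lemma Ri_of_C_M (z w : C) : Ri_of_C (z * w)%C = (Ri_of_C z * Ri_of_C w)%R.
Proof. by []. Qed.

Lemma Ri_of_C_inj : injective Ri_of_C.
Proof. by move=> [a b] [c d] [-> ->]. Qed.

Lemma Ri_of_C_sum (F : nat -> C) (n : nat) :
  Ri_of_C (sum_n F n) = (\sum_(i < n.+1) Ri_of_C (F i))%R.
Proof.
elim: n => [|n IH]; first by rewrite csum_0 big_ord_recl big_ord0 addr0.
by rewrite csum_S Ri_of_C_D IH [RHS]big_ord_recr.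
Qed.

Lemma Ri_of_C_X (z : C) (n : nat) : Ri_of_C (Cpow z n) = (Ri_of_C z ^+ n)%R.
Proof. by elim: n => [|n IH] //; rewrite exprS -IH -Ri_of_C_M. Qed.

Lemma csum_poly (F : nat -> C) (g : C) (m n : nat) : (m <= n)%N ->
  (forall i, (m < i)%N -> F i = RtoC 0) ->
  Ri_of_C (sum_n (fun i => (F i * Cpow g i)%C) n) = (\poly_(i < m.+1) Ri_of_C
    (F i)).[Ri_of_C g]%R.
Proof.
move=> mn h; rewrite Ri_of_C_sum horner_poly.
rewrite (big_ord_widen n.+1 (fun i => Ri_of_C (F i) * Ri_of_C g ^+ i)%R) // [RHS]big_mkcond.
apply: eq_bigr => i _; rewrite Ri_of_C_M Ri_of_C_X.
by case: ltnP => // hi; rewrite h // mul0r.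
Qed.

(** The product of two polynomials, in the form in which it occurs in the
    definition of irreducibility; it is inherited from the polynomial ring over
    [R[i]]. *)
Lemma csum_cauchy (b c : nat -> C) (g : C) (m l n : nat) : (m + l <= n)%N ->
  (forall i, (m < i)%N -> b i = RtoC 0) -> (forall i, (l < i)%N -> c i = RtoC 0) ->
  (sum_n (fun i => (sum_n (fun q => b q * c (i - q)%N) i * Cpow g i)%C) n : C)
  = (sum_n (fun i => b i * Cpow g i) m * sum_n (fun i => c i * Cpow g i) l)%C.
Proof.
move=> mln hb hc; apply: Ri_of_C_inj; rewrite Ri_of_C_M.
rewrite (csum_poly g (leqnn m) hb) (csum_poly g (leqnn l) hc) -hornerM.
set p := (\poly_(i < m.+1) _)%R; set q := (\poly_(i < l.+1) _)%R.
have pE i : Ri_of_C (b i) = (p`_i)%R by rewrite coef_poly ltnS; case: leqP => // /hb ->.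
have qE i : Ri_of_C (c i) = (q`_i)%R by rewrite coef_poly ltnS; case: leqP => // /hc ->.
have pq : (size (p * q)%R <= n.+1)%N.
  apply: leq_trans (size_polyMleq _ _) _.
  by have := size_poly m.+1 (fun i => Ri_of_C (b i));
    have := size_poly l.+1 (fun i => Ri_of_C (c i));
    rewrite -/p -/q; lia.
rewrite Ri_of_C_sum (horner_coef_wide _ pq); apply: eq_bigr => i _.
rewrite Ri_of_C_M Ri_of_C_X coefM Ri_of_C_sum; congr (_ * _)%R; apply: eq_bigr => j _.
by rewrite Ri_of_C_M pE qE.
Qed.

End Cauchy.

Section Minimal.

Variables (J : R -> Prop) (K : (R -> C) -> Prop).
Hypotheses (hJ : open_interval J) (hK : is_field J K).

Lemma field_sum (L : (R -> C) -> Prop) (F : nat -> R -> C) (n : nat) : is_field J L ->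
  (forall i, L (F i)) -> L (fun x => sum_n (fun i => F i x) n : C).
Proof.
move=> hL hF; elim: n => [|n IH].
  by have -> : (fun x => sum_n (fun i => F i x) 0 : C) = F 0%N
    by apply: functional_extensionality => x; rewrite csum_0.
have -> : (fun x => sum_n (fun i => F i x) n.+1 : C)
    = (fun x => (sum_n (fun i => F i x) n + F n.+1 x)%C).
  by apply: functional_extensionality => x; rewrite csum_S.
exact: (field_plus hL).
Qed.

Lemma field_pow (L : (R -> C) -> Prop) (g : R -> C) (n : nat) : is_field J L ->
  L g -> L (fun x => Cpow (g x) n).
Proof.
move=> hL hg; elim: n => [|n IH]; first exact: (field_const hL).
exact: (field_mult hL).
Qed.

Lemma field_poly_eval (L : (R -> C) -> Prop) (a : nat -> R -> C) (g : R -> C) (n : nat) :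
  is_field J L -> (forall i, L (a i)) -> L g -> L (poly_eval n a g).
Proof.
move=> hL ha hg; apply: (field_sum (F := fun i x => (a i x * Cpow (g x) i)%C)) => // i.
by apply: (field_mult hL) => //; exact: (field_pow).
Qed.

Variable g : R -> C.
Hypothesis hg : quotient_of_analytic J g.

Lemma adjoin_is_field : is_field J (adjoin J K g).
Proof. exact: adjoin_field hJ (field_quotient hK) (field_const hK) hg. Qed.

Lemma poly_eval_quotient (a : nat -> R -> C) (n : nat) : (forall i, K (a i)) ->
  quotient_of_analytic J (poly_eval n a g).
Proof.
move=> ha; apply: (field_quotient adjoin_is_field); apply: field_poly_eval.
- exact: adjoin_is_field.
- by move=> i; exact: adjoin_base.
- exact: adjoin_gen.
Qed.

Definition vanishing (n : nat) (a : nat -> R -> C) : Prop :=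
  poly_of_degree J K n a /\ same J (poly_eval n a g) zero_fun.

Definition minimal_vanishing (n : nat) (a : nat -> R -> C) : Prop :=
  vanishing n a /\ forall m b, vanishing m b -> (n <= m)%N.

Lemma exists_minimal_vanishing (n : nat) (a : nat -> R -> C) : vanishing n a ->
  exists m b, minimal_vanishing m b.
Proof.
elim/ltn_ind: n a => n IH a ha.
case: (classic (exists m b, (m < n)%N /\ vanishing m b)) => [[m [b [lt hb]]]|H].
  exact: IH lt b hb.
exists n, a; split=> // m b hb; rewrite leqNgt; apply/negP => lt.
by apply: H; exists m, b.
Qed.

Lemma vanishing_gt0 (n : nat) (a : nat -> R -> C) : vanishing n a -> (0 < n)%N.
Proof.
move=> [[_ an _] h]; case: n an h => // an h; case: an; apply: generically_imp h => x _.
by rewrite /poly_eval csum_0 /= Cmult_1_r.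
Qed.

(** If [a] is the product of [b] and [c], then [b] or [c] vanishes at [g], so it
    has at least the degree of [a] and the other factor is constant. *)
Lemma minimal_irreducible (n : nat) (a : nat -> R -> C) :
  minimal_vanishing n a -> irreducible J K n a.
Proof.
move=> [va hmin]; have [[Ka an az] ha] := va; split; [exact: vanishing_gt0 va | by split | ].
move=> m l b c hb hc e; have [Kb bm bz] := hb; have [Kc cl cz] := hc.
have gz d (p : nat -> R -> C) : (forall i, (d < i)%N -> same J (p i) zero_fun) ->
    generically J (fun x => forall i, (i <= n + m + l)%N -> (d < i)%N -> p i x = RtoC 0).
  move=> h; apply: (generically_and_n hJ (P := fun i x => (d < i)%N -> p i x = RtoC 0)) => i.
  by case: (ltnP d i) => [/h|lt]; [apply: generically_imp | apply: generically_all].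
have ge : generically J (fun x => forall i, (i <= n + m + l)%N ->
    a i x = sum_n (fun q => b q x * c (i - q)%N x)%C i).
  exact: generically_and_n.
have nb := generically_neq0 hJ (field_quotient hK (Kb m)) bm.
have nc := generically_neq0 hJ (field_quotient hK (Kc l)) cl.
have gall := generically_and hJ (generically_and hJ (gz m b bz) (gz l c cz)) ge.
(* The coefficients vanish beyond the degrees only generically and for finitely
   many indices at a time; [cut] makes them vanish for all larger indices. *)
pose cut (p : nat -> R -> C) x i := if (i <= n + m + l)%N then p i x else RtoC 0.
have cutE p x i : (i <= n + m + l)%N -> cut p x i = p i x by rewrite /cut => ->.
have cutz d p x : (forall i, (i <= n + m + l)%N -> (d < i)%N -> p i x = RtoC 0) ->
    forall i, (d < i)%N -> cut p x i = RtoC 0.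
  by move=> h i hi; rewrite /cut; case: ifP => // le; exact: h.
(* The coefficient of [a] at [m + l] is the nonzero product of the leading
   coefficients of [b] and [c]. *)
have mln : (m + l <= n)%N.
  rewrite leqNgt; apply/negP => lt.
  have [x Jx [[[[hbx hcx] ex] az0] [bx cx]]] :=
    generically_ex (generically_and hJ (generically_and hJ gall (az _ lt))
      (generically_and hJ nb nc)).
  have : (b m x * c l x)%C = RtoC 0.
    transitivity (a (m + l)%N x); last exact: az0.
    rewrite ex; last by lia.
    rewrite (csum_single (leq_addr l m)) ?addKn // => i hi ne.
    case: (ltnP m i) => [lt1|le1]; first by rewrite hbx ?Cmult_0_l //; lia.
    by rewrite hcx ?Cmult_0_r //; lia.
  exact: Cmult_neq_0.
have prod : same J (fun x => (poly_eval m b g x * poly_eval l c g x)%C) zero_fun.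
  apply: (generically_imp_2 hJ _ gall ha) => x _ [[hbx hcx] ex] <-.
  rewrite /poly_eval (csum_ext (F := fun i => (b i x * _)%C) (G :=
    fun i => (cut b x i * Cpow (g x) i)%C)); last first.
    by move=> i hi; rewrite cutE //; lia.
  rewrite (csum_ext (F := fun i => (c i x * _)%C) (G :=
    fun i => (cut c x i * Cpow (g x) i)%C)); last first.
    by move=> i hi; rewrite cutE //; lia.
  rewrite -(csum_cauchy _ mln (cutz _ _ _ hbx) (cutz _ _ _ hcx)).
  apply: csum_ext => i hi; rewrite ex; last by lia.
  by congr Cmult; apply: csum_ext => q hq; rewrite !cutE //; lia.
case: (classic (same J (poly_eval m b g) zero_fun)) => [hb0|nb0].
  have := hmin m b (conj hb hb0); right; lia.
case: (classic (same J (poly_eval l c g) zero_fun)) => [hc0|nc0].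
  have := hmin l c (conj hc hc0); left; lia.
have h1 := generically_neq0 hJ (poly_eval_quotient m Kb) nb0;
  have h2 := generically_neq0 hJ (poly_eval_quotient l Kc) nc0.
have [x _ [[n1 n2] e0]] := generically_ex (generically_and hJ (generically_and hJ h1 h2) prod).
by case: (Cmult_neq_0 _ _ n1 n2).
Qed.

(** Algebraic generators need only a nonzero polynomial that vanishes at them;
    this makes the notion stable when the field [K] grows. *)
Lemma vanishing_algebraic (n : nat) (a : nat -> R -> C) :
  vanishing n a -> algebraic_over J K g.
Proof.
case/exists_minimal_vanishing => m [b hb]; exists m, b; split.
- exact: minimal_irreducible.
- by case: hb => [[]].
Qed.

End Minimal.

(** * Elementary fields *)

Lemma cderive_eqr (F : R -> C) (x : R) (l m : C) : l = m -> is_cderive F x l ->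
  is_cderive F x m.
Proof. by move=> ->. Qed.

Lemma cderive_pow (g : R -> C) (x : R) (l : C) (n : nat) : is_cderive g x l ->
  is_cderive (fun y => Cpow (g y) n.+1) x (RtoC (INR n.+1) * Cpow (g x) n * l)%C.
Proof.
move=> hg; elim: n => [|n IH].
  by apply: cderive_eqr (cderive_mult hg (cderive_const (RtoC 1) x)); rewrite /=; ring.
apply: cderive_eqr (cderive_mult hg IH).
by rewrite [in RHS]S_INR RtoC_plus /=; ring.
Qed.

(** The chain rule for a polynomial with variable coefficients; the second
    polynomial is the formal derivative of the first. *)
Lemma cderive_poly_eval (a da : nat -> R -> C) (g : R -> C) (x : R) (l : C) (n : nat) :
  (forall i, (i <= n.+1)%N -> is_cderive (a i) x (da i x)) -> is_cderive g x l ->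
  is_cderive (poly_eval n.+1 a g) x
    (poly_eval n.+1 da g x + poly_eval n (fun i y => (RtoC (INR i.+1) * a i.+1 y)%C) g x * l)%C.
Proof.
move=> ha hg.
have E m : poly_eval m.+1 a g = fun y => (poly_eval m a g y + a m.+1 y * Cpow (g y) m.+1)%C.
  by apply: functional_extensionality => y; rewrite /poly_eval csum_S.
have hS m : (m <= n)%N -> is_cderive (fun y => (a m.+1 y * Cpow (g y) m.+1)%C) x
    (da m.+1 x * Cpow (g x) m.+1 + a m.+1 x * (RtoC (INR m.+1) * Cpow (g x) m * l))%C.
  by move=> hm; apply: cderive_mult (cderive_pow m hg); exact: ha.
elim: n ha hS => [|n IH] ha hS; rewrite E.
  have h0 : is_cderive (poly_eval 0 a g) x (poly_eval 0 da g x).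
    have -> : poly_eval 0 a g = fun y => (a 0%N y * RtoC 1)%C.
      by apply: functional_extensionality => y; rewrite /poly_eval csum_0.
    apply: cderive_eqr (cderive_mult (ha 0%N isT) (cderive_const (RtoC 1) x)).
    by rewrite /poly_eval csum_0 /=; ring.
  by apply: cderive_eqr (cderive_plus h0 (hS 0%N isT)); rewrite /poly_eval csum_S !csum_0 /=;
    ring.
have IH' := IH (fun i hi => ha i (leqW hi)) (fun i hi => hS i (leqW hi)).
apply: cderive_eqr (cderive_plus IH' (hS n.+1 (leqnn _))).
rewrite /poly_eval [in RHS]csum_S [X in _ = (_ + X * _)%C]csum_S.
set A := sum_n _ n.+1; set B := sum_n _ n; rewrite /=; ring.
Qed.

Section Derivation.

Variable J : R -> Prop.
Hypothesis hJ : open_interval J.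

Lemma quotient_cderive (F : R -> C) : quotient_of_analytic J F ->
  generically J (fun x => is_cderive F x (Dx F x)).
Proof. by move/(quotient_analytic_at hJ); apply: generically_imp => x _;
  exact: analytic_at_cderive. Qed.

Lemma adjoin_Dx (K : (R -> C) -> Prop) (g : R -> C) :
  is_field J (adjoin J K g) -> (forall F, K F -> adjoin J K g (Dx F)) ->
  adjoin J K g (Dx g) -> forall F, adjoin J K g F -> adjoin J K g (Dx F).
Proof.
move=> hL hK hg F.
have same_mem F' G' := @adjoin_same J K g F' G'.
elim=> {F} [F|//|F G hF dF hG dG|F hF dF|F G hF dF hG dG|F hF dF nF|F G hF dF e].
- exact: hK.
- apply: same_mem (adjoin_add dF dG) _.
  apply: (generically_imp_2 hJ _ (quotient_cderive (field_quotient hL hF)) (quotient_cderive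
    (field_quotient hL hG))) => x _ h1 h2.
  by rewrite (cderive_Dx (cderive_plus h1 h2)).
- apply: same_mem (adjoin_opp dF) _.
  apply: (generically_imp _ (quotient_cderive (field_quotient hL hF))) => x _ h.
  by rewrite (cderive_Dx (cderive_opp h)).
- apply: same_mem (adjoin_add (adjoin_mul dF hG) (adjoin_mul hF dG)) _.
  apply: (generically_imp_2 hJ _ (quotient_cderive (field_quotient hL hF)) (quotient_cderive
    (field_quotient hL hG))) => x _ h1 h2.
  by rewrite (cderive_Dx (cderive_mult h1 h2)).
- have iF := adjoin_inv hF nF.
  apply: same_mem (adjoin_opp (adjoin_mul dF (adjoin_mul iF iF))) _.
  have nz := generically_neq0 hJ (field_quotient hL hF) nF.
  apply: (generically_imp_2 hJ _ (generically_and hJ nz (generically_locally hJ nz))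
    (generically_and hJ (quotient_cderive (field_quotient hL hF)) (quotient_cderive
      (field_quotient hL iF)))).
  move=> x _ [n1 n2] [h1 h2].
  (* The derivative of 1 / F is found from F (1 / F) = 1. *)
  have h3 : is_cderive (fun y => (F y * / F y)%C) x (RtoC 0).
    apply: cderive_ext_loc (cderive_const (RtoC 1) x).
    by apply: filter_imp n2 => y hy; rewrite Cinv_r.
  have := cderive_Dx h3; rewrite (cderive_Dx (cderive_mult h1 h2)) => h.
  have -> : Dx (fun y => (/ F y)%C) x
     = (/ F x * (Dx F x * / F x + F x * Dx (fun y =>
       (/ F y)%C) x) - Dx F x * (/ F x * / F x))%C.
    by field.
  by rewrite h; ring.
- by apply: same_mem dF _; exact: same_Dx.
Qed.

(** Differentiating the minimal equation of [g] expresses [Dx g] in K(g): the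
    coefficient of [Dx g] is a polynomial in [g] of smaller degree, hence is not
    zero. *)
Lemma algebraic_Dx (K : (R -> C) -> Prop) (g : R -> C) : is_field J K ->
  quotient_of_analytic J g -> (forall F, K F -> K (Dx F)) ->
  algebraic_over J K g -> adjoin J K g (Dx g).
Proof.
move=> hK hg dK [n0 [a0 [[_ va0 _] ha0]]].
have [n [a [[va ha] hmin]]] := exists_minimal_vanishing (conj va0 ha0).
have n_gt0 := vanishing_gt0 (conj va ha).
case: n n_gt0 va ha hmin => // n _ [Ka an az] ha hmin.
have hL := adjoin_is_field hJ hK hg.
pose q i y := (RtoC (INR i.+1) * a i.+1 y)%C.
have Kq i : K (q i) by apply: (field_mult hK) => //; exact: (field_const hK).
have INRn0 i : RtoC (INR i.+1) <> RtoC 0 by move/RtoC_inj; exact: not_0_INR.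
have vq : poly_of_degree J K n q.
  split=> //.
  - move=> h; apply: an; apply: generically_imp h => x _ h.
    rewrite -[LHS]Cmult_1_l -(Cinv_l _ (INRn0 n)) -Cmult_assoc.
    by rewrite -/(q n x) h /zero_fun Cmult_0_r.
  - move=> i hi; apply: generically_imp (az i.+1 hi) => x _ h.
    by rewrite /q h /zero_fun Cmult_0_r.
have nq : ~ same J (poly_eval n q g) zero_fun.
  by move=> h; have := hmin n q (conj vq h); rewrite ltnn.
pose da i := Dx (a i).
have Lp m p : (forall i, K (p i)) -> adjoin J K g (poly_eval m p g).
  move=> hp; apply: field_poly_eval hL _ (adjoin_gen _ _ _) => i; exact: adjoin_base.
have Lq := Lp n q Kq; have Lda := Lp n.+1 da (fun i => dK _ (Ka i)).
apply: adjoin_same (adjoin_opp (adjoin_mul Lda (adjoin_inv Lq nq))) _.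
have nz := generically_neq0 hJ (field_quotient hL Lq) nq.
have ca : generically J (fun x => forall i, (i <= n.+1)%N -> is_cderive (a i) x (da i x)).
  by apply: (generically_and_n hJ) => i; apply: quotient_cderive; exact: (field_quotient hK).
apply: (generically_imp_2 hJ _ (generically_and hJ ca (quotient_cderive hg))
  (generically_and hJ nz (generically_locally hJ ha))).
move=> x _ [h1 h2] [n1 e].
have h3 : is_cderive (poly_eval n.+1 a g) x (RtoC 0).
  by apply: cderive_ext_loc (cderive_const (RtoC 0) x); apply: filter_imp e => y ->.
have := cderive_Dx h3; rewrite (cderive_Dx (cderive_poly_eval h1 h2)) -/q => h.
have -> : Dx g x = (/ poly_eval n q g x * (poly_eval n.+1 da g x + poly_eval n q g x * Dx g x)
    - poly_eval n.+1 da g x * / poly_eval n q g x)%C by field.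
by rewrite h; ring.
Qed.

Lemma elementary_Dx (K : (R -> C) -> Prop) : elementary_field J K ->
  forall F, K F -> K (Dx F).
Proof.
elim=> {K} [|K g hK dK hg ext].
  have hL := elementary_is_field hJ (elementary_field_rational J).
  apply: adjoin_Dx => //.
  - move=> F [c e]; apply: (field_same hL (field_const hL (RtoC 0))).
    apply: generically_imp (same_Dx hJ e) => x _ ->.
    by rewrite (cderive_Dx (cderive_const c x)).
  - apply: (field_same hL (field_const hL (RtoC 1))); apply: generically_all => // x _.
    symmetry; apply: cderive_Dx; split; first exact: is_derive_id.
    exact: is_derive_const.
have fK := elementary_is_field hJ hK.
have hL := adjoin_is_field hJ fK hg.
apply: adjoin_Dx => //; first by move=> F KF; apply: adjoin_base; exact: dK.
case: ext => [[s Ks e]|[[s [Ks ns e]]|alg]].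
- apply: adjoin_same (same_sym e).
  by apply: adjoin_mul (adjoin_gen _ _ _); apply: adjoin_base; exact: dK.
- apply: adjoin_same (same_sym e).
  by apply: adjoin_mul; [apply: adjoin_base; exact: dK | apply: adjoin_inv => //;
    exact: adjoin_base].
- exact: algebraic_Dx.
Qed.

End Derivation.

Lemma elementary_id (J : R -> Prop) (K : (R -> C) -> Prop) :
  elementary_field J K -> K RtoC.
Proof. by elim=> {K} [|K g _ IH _ _]; [exact: adjoin_gen | exact: adjoin_base]. Qed.

(** Towers can be restricted to a subinterval and composed: the generators of
    a tower on [I] can be adjoined to any elementary field on [J]. *)
Lemma elementary_compositum (I J : R -> Prop) (K1 K2 : (R -> C) -> Prop) :
  open_interval I -> open_interval J -> (forall x, J x -> I x) ->
  elementary_field J K1 -> elementary_field I K2 ->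
  exists K, [/\ elementary_field J K, forall F, K1 F -> K F & forall F, K2 F -> K F].
Proof.
move=> hI hJ sub e1.
have nsame F : quotient_of_analytic I F -> ~ same I F zero_fun -> ~ same J F zero_fun.
  move=> hF /(generically_neq0 hI hF) h; apply: generically_neq0_not_same => //.
  exact: generically_restrict h.
have adj (L K : (R -> C) -> Prop) g : (forall F, L F -> quotient_of_analytic I F) ->
    quotient_of_analytic I g -> is_field J K -> (forall F, L F -> K F) -> K g ->
    forall F, adjoin I L g F -> K F.
  move=> hL hg hK LK Kg F.
  elim=> {F} [F|//|F G _ hF _ hG|F _ hF|F G _ hF _ hG|F aF hF nF|F G _ hF e].
  - exact: LK.
  - exact: (field_plus hK).
  - exact: (field_opp hK).
  - exact: (field_mult hK).
  - by apply: (field_inv hK hF); apply: nsame nF; exact: adjoin_quotient hL hg _ aF.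
  - by apply: (field_same hK hF); exact: generically_restrict e.
elim=> {K2} [|L g eL [K [eK s1 s2]] hg ext].
  exists K1; split=> //; have hK := elementary_is_field hJ e1.
  apply: adj => //.
  - exact: constants_quotient.
  - by apply: quotient_analytic => //; exact: analytic_RtoC.
  - move=> F [c e]; apply: (field_same hK (field_const hK c)).
    by apply: same_sym; exact: generically_restrict e.
  - exact: elementary_id e1.
have hL := elementary_is_field hI eL; have hK := elementary_is_field hJ eK.
have gJ : quotient_of_analytic J g by exact: quotient_restrict hg.
exists (adjoin J K g); split.
- apply: elementary_field_adjoin => //; case: ext => [[s Ls e]|[[s [Ls ns e]]|alg]].
  + by left; exists s; [exact: s2 | exact: generically_restrict e].
  + right; left; exists s; split; [exact: s2 | | exact: generically_restrict e].
    by apply: nsame ns; exact: (field_quotient hL).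
  + right; right; case: alg => n [a [[_ [La an az] _] ha]].
    apply: (vanishing_algebraic hJ hK gJ (n := n) (a := a)); split.
      split; [by move=> i; exact: s2 | by apply: nsame an; exact: (field_quotient hL) | ].
      by move=> i /az; exact: generically_restrict.
    exact: generically_restrict ha.
- by move=> F /s1; exact: adjoin_base.
- apply: adj hg (adjoin_is_field hJ hK gJ) _ (adjoin_gen _ _ _).
  + exact: (field_quotient hL).
  + by move=> F /s2; exact: adjoin_base.
Qed.

(** * Elementary functions *)

(** Smoothness rules out poles, so elementary functions are analytic. *)
Lemma elementary_onE (J : R -> Prop) (F : R -> C) : open_interval J -> elementary_on J F <->
  analytic_on J F /\ exists2 K, elementary_field J K & K F.
Proof.
move=> hJ; split=> [[sF [K eK KF]]|[aF hF]]; last by split=> //; exact: analytic_smooth.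
split; last by exists K.
apply: (continuous_quotient_analytic hJ (field_quotient (elementary_is_field hJ eK) KF)) =>
  x Jx.
exact: smooth_ccontinuous sF Jx.
Qed.

Lemma elementary_analytic (J : R -> Prop) (F : R -> C) : open_interval J ->
  elementary_on J F -> analytic_on J F.
Proof. by move=> hJ /(elementary_onE _ hJ) []. Qed.

Section Elementary.

Variable J : R -> Prop.
Hypothesis hJ : open_interval J.

Lemma elementary_common (F G : R -> C) : elementary_on J F -> elementary_on J G ->
  exists K, [/\ elementary_field J K, K F & K G].
Proof.
move=> [_ [K1 e1 KF]] [_ [K2 e2 KG]].
have [K [eK s1 s2]] := elementary_compositum hJ hJ (fun _ h => h) e1 e2.
by exists K; split; [|exact: s1|exact: s2].
Qed.

Lemma elementary_const (c : C) : elementary_on J (fun _ => c).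
Proof.
apply/elementary_onE => //; split; first exact: analytic_const.
have eR := elementary_field_rational J; exists (rational_functions J) => //.
exact: (field_const (elementary_is_field hJ eR)).
Qed.

Lemma elementary_plus (F G : R -> C) : elementary_on J F -> elementary_on J G ->
  elementary_on J (fun x => (F x + G x)%C).
Proof.
move=> hF hG; have [K [eK KF KG]] := elementary_common hF hG.
apply/elementary_onE => //; split.
  by apply: analytic_plus; exact: elementary_analytic.
by exists K => //; exact: (field_plus (elementary_is_field hJ eK)).
Qed.

Lemma elementary_mult (F G : R -> C) : elementary_on J F -> elementary_on J G ->
  elementary_on J (fun x => (F x * G x)%C).
Proof.
move=> hF hG; have [K [eK KF KG]] := elementary_common hF hG.
apply/elementary_onE => //; split.
  by apply: analytic_mult; exact: elementary_analytic.
by exists K => //; exact: (field_mult (elementary_is_field hJ eK)).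
Qed.

Lemma elementary_minus (F G : R -> C) : elementary_on J F -> elementary_on J G ->
  elementary_on J (fun x => (F x - G x)%C).
Proof.
move=> hF hG.
have -> : (fun x => (F x - G x)%C) = (fun x => (F x + - RtoC 1 * G x)%C).
  by apply: functional_extensionality => x; ring.
by apply: elementary_plus => //; apply: elementary_mult => //; exact: elementary_const.
Qed.

Lemma elementary_on_Dx (F : R -> C) : elementary_on J F -> elementary_on J (Dx F).
Proof.
move=> hF; have [_ [K eK KF]] := hF.
apply/elementary_onE => //; split.
  by apply: analytic_Dx; exact: elementary_analytic.
by exists K => //; exact: (elementary_Dx hJ eK).
Qed.

Lemma elementary_ext (F G : R -> C) : (forall x, J x -> F x = G x) ->
  elementary_on J F -> elementary_on J G.
Proof.
move=> e /(elementary_onE _ hJ) [/analytic_onP aF [K eK KF]]; apply/elementary_onE => //; split.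
  apply/analytic_onP => x Jx; apply: analytic_at_ext_loc (aF x Jx).
  by apply: filter_imp (open_interval_open hJ Jx).
by exists K => //; apply: (field_same (elementary_is_field hJ eK) KF); exact: generically_all.
Qed.

(** The logarithm [L] of [h] is a logarithmic generator: it is analytic, as a
    primitive of the analytic function h'/h. *)
Lemma elementary_log (h L : R -> C) : elementary_on J h ->
  (forall x, J x -> h x <> RtoC 0) ->
  (forall x, J x -> is_cderive L x (Dx h x / h x)%C) -> elementary_on J L.
Proof.
move=> hh h0 hL; have [_ [K eK Kh]] := hh.
have /analytic_onP ah := elementary_analytic hJ hh.
have aL : analytic_on J L.
  apply/analytic_onP => x Jx.
  apply: (analytic_at_primitive (f := fun y => (Dx h y / h y)%C)).
    by apply: filter_imp (open_interval_open hJ Jx).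
  by apply: analytic_at_mult; [apply: analytic_at_Dx; exact: ah | apply: analytic_at_inv;
    [exact: ah | exact: h0]].
apply/elementary_onE => //; split=> //.
exists (adjoin J K L); last exact: adjoin_gen.
apply: elementary_field_adjoin => //; first exact: quotient_analytic.
right; left; exists h; split=> //.
- by apply: generically_neq0_not_same => //; exact: generically_all.
- by apply: generically_all => // x Jx; apply: cderive_Dx; exact: hL.
Qed.

End Elementary.

Lemma elementary_restrict (I J : R -> Prop) (F : R -> C) : open_interval I -> open_interval J ->
  (forall x, J x -> I x) -> elementary_on I F -> elementary_on J F.
Proof.
move=> hI hJ sub [sF [K eK KF]].
have [L [eL _ s]] := elementary_compositum hI hJ sub (elementary_field_rational J) eK.
split; first by move=> n x /sub; exact: sF.
by exists L => //; exact: s.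
Qed.

(** * Branches of the roots of P(u) = d *)

Fixpoint eval_list (ps : seq C) (z : C) : C :=
  match ps with
  | [::] => RtoC 0
  | p :: ps' => (p + z * eval_list ps' z)%C
  end.

Lemma eval_list_scal (c : C) (ps : seq C) (z : C) :
  eval_list [seq (c * p)%C | p <- ps] z = (c * eval_list ps z)%C.
Proof. by elim: ps => [|p ps IH] /=; [ring | rewrite IH; ring]. Qed.

Lemma eval_list_plus (ps qs : seq C) :
  exists rs, forall z, eval_list rs z = (eval_list ps z + eval_list qs z)%C.
Proof.
elim: ps qs => [|p ps IH] [|q qs].
- by exists [::] => z /=; ring.
- by exists (q :: qs) => z /=; ring.
- by exists (p :: ps) => z /=; ring.
- by have [rs h] := IH qs; exists ((p + q)%C :: rs) => z /=; rewrite h; ring.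
Qed.

Lemma nest_eval_list (c : C) (ps : seq C) (z : R -> C) (y : R) :
  nest [seq (fun _ => (c * p)%C) | p <- ps] z y = (c * eval_list ps (z y))%C.
Proof. by elim: ps => [|p ps IH] /=; [ring | rewrite IH; ring]. Qed.

Lemma Peval_S (N : nat) (c : nat -> C) (u : C) :
  Peval N.+1 c u = (c 0%N + u * Peval N (fun i => c i.+1) u)%C.
Proof.
rewrite /Peval; elim: N => [|N IH]; first by rewrite csum_S !csum_0 /=; ring.
by rewrite csum_S IH [in RHS]csum_S /=; ring.
Qed.

(** Taylor's formula of order 1; the remainder is again a polynomial, to which
    [implicit_analytic_at] can be applied. *)
Lemma Peval_taylor (N : nat) (c : nat -> C) (u0 : C) : exists p1 ps, forall z,
  Peval N c (u0 + z)%C = (Peval N c u0 + z * (p1 + z * eval_list ps z))%C.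
Proof.
elim: N c => [|N IH] c.
  by exists (RtoC 0), [::] => z; rewrite /Peval !csum_0 /=; ring.
have [p1 [ps h]] := IH (fun i => c i.+1).
have [rs hr] := eval_list_plus [seq (u0 * p)%C | p <- ps] (p1 :: ps).
exists (Peval N (fun i => c i.+1) u0 + u0 * p1)%C, rs => z.
by rewrite !Peval_S h hr eval_list_scal /=; ring.
Qed.

(** Restricting to a horizontal line turns complex differentiability into the
    differentiability of a function of a real variable. *)
Lemma ex_derive_horizontal (alpha : C -> C) (d : C) :
  ex_derive (K := C_AbsRing) (V := C_NormedModule) alpha d ->
  exists l, is_cderive (fun h : R => alpha (d + RtoC h)%C) 0 l.
Proof.
case=> l [_ hl]; exists l.
have {}hl (e : posreal) : locally (T := AbsRing_UniformSpace C_AbsRing) d (fun y =>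
    Cmod (alpha y - alpha d - (y - d) * l)%C <= e * Cmod (y - d)%C).
  by apply: (hl d (fun P h => h)).
have dom (e : R) : 0 < e -> exists2 r, 0 < r & forall h, Rabs h < r ->
    Cmod (alpha (d + RtoC h) - alpha (d + RtoC 0) - RtoC h * l)%C <= e * Rabs h.
  move=> e0; case: (hl (mkposreal e e0)) => r hr; exists r; first exact: cond_pos.
  move=> h hh; have := hr (d + RtoC h)%C.
  rewrite Cplus_0_r (_ : (d + RtoC h - d)%C = RtoC h); last by ring.
  rewrite Cmod_R /=; apply; rewrite /ball /= /AbsRing_ball.
  change (Cmod (d + RtoC h - d)%C < r).
  by rewrite (_ : (d + RtoC h - d)%C = RtoC h) ?Cmod_R //; ring.
split; apply/is_derive_Reals => e e0.
- have [r r0 hr] := dom (e / 2) ltac:(lra).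
  exists (mkposreal r r0) => h h0 hh; rewrite Rplus_0_l.
  have := Rle_trans _ _ _ (Rle_trans _ _ _ (Rmax_l _ _) (Rmax_Cmod _)) (hr h hh).
  rewrite /re_part; set A := fst (alpha _); set B := fst (alpha _) => H.
  have hp : 0 < Rabs h by exact: Rabs_pos_lt.
  have -> : (A - B) / h - fst l = (A - B - h * fst l) / h by field.
  rewrite Rabs_div //; apply: (Rle_lt_trans _ (e / 2)); last lra.
  apply: (Rmult_le_reg_r (Rabs h)) => //; rewrite /Rdiv Rmult_assoc Rinv_l ?Rmult_1_r; last lra.
  apply: Rle_trans H; apply: Req_le; congr Rabs; rewrite /A /B /=; ring.
- have [r r0 hr] := dom (e / 2) ltac:(lra).
  exists (mkposreal r r0) => h h0 hh; rewrite Rplus_0_l.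
  have := Rle_trans _ _ _ (Rle_trans _ _ _ (Rmax_r _ _) (Rmax_Cmod _)) (hr h hh).
  rewrite /im_part; set A := snd (alpha _); set B := snd (alpha _) => H.
  have hp : 0 < Rabs h by exact: Rabs_pos_lt.
  have -> : (A - B) / h - snd l = (A - B - h * snd l) / h by field.
  rewrite Rabs_div //; apply: (Rle_lt_trans _ (e / 2)); last lra.
  apply: (Rmult_le_reg_r (Rabs h)) => //; rewrite /Rdiv Rmult_assoc Rinv_l ?Rmult_1_r; last lra.
  apply: Rle_trans H; apply: Req_le; congr Rabs; rewrite /A /B /=; ring.
Qed.

Lemma cderive_eval_list (ps : seq C) (z : R -> C) (x : R) (l : C) : is_cderive z x l ->
  exists m, is_cderive (fun y => eval_list ps (z y)) x m.
Proof.
move=> hz; elim: ps => [|p ps [m IH]]; first by exists (RtoC 0); exact: cderive_const.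
by eexists; apply: cderive_plus (cderive_const p x) (cderive_mult hz IH).
Qed.

(** [P'(alpha d)] does not vanish: otherwise [P(alpha (d + h)) - d = h] would be
    of second order in [h]. *)
Lemma root_branch_simple (N : nat) (c : nat -> C) (Omega : C -> Prop)
    (alpha : C -> C) (d p1 : C) (ps : seq C) :
  root_branch N c Omega alpha -> Omega d ->
  (forall z, Peval N c (alpha d + z)%C
     = (Peval N c (alpha d) + z * (p1 + z * eval_list ps z))%C) ->
  p1 <> RtoC 0.
Proof.
move=> [oO dO eO] Od hP p0.
have [l hl] := ex_derive_horizontal (dO d Od).
pose z (h : R) := (alpha (d + RtoC h)%C - alpha d)%C.
have z0 : z 0 = RtoC 0 by rewrite /z Cplus_0_r; ring.
have hz : is_cderive z 0 l.
  apply: cderive_eqr (cderive_plus hl (cderive_const (- alpha d)%C 0)); ring.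
have [m hm] := cderive_eval_list ps hz.
have near : locally 0 (fun h => Omega (d + RtoC h)%C).
  case: (oO d Od) => r hr; apply/locally_ball_R; exists r; first exact: cond_pos.
  move=> h hh; apply: hr; rewrite Rminus_0_r in hh; split.
    change (Rabs (fst d + h - fst d) < r).
    by rewrite (_ : fst d + h - fst d = h) //; ring.
  change (Rabs (snd d + 0 - snd d) < r).
  by rewrite (_ : snd d + 0 - snd d = 0) ?Rabs_R0; [exact: cond_pos | ring].
have e : locally 0 (fun h => RtoC h = (z h * (z h * eval_list ps (z h)))%C).
  apply: filter_imp near => h Oh.
  have := eO _ Oh; have -> : alpha (d + RtoC h)%C = (alpha d + z h)%C by rewrite /z; ring.
  rewrite hP (eO d Od) p0 Cplus_0_l => E.
  have -> : RtoC h = (d + RtoC h - d)%C by ring.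
  by rewrite -E; ring.
have h1 : is_cderive RtoC 0 (RtoC 1) by split; [exact: is_derive_id | exact: is_derive_const].
have h2 := cderive_Dx (cderive_ext_loc e h1).
have := cderive_Dx (cderive_mult hz (cderive_mult hz hm)); rewrite h2 z0 => h3.
by apply: C1_neq0; rewrite h3; ring.
Qed.

Lemma ccontinuous_comp (alpha : C -> C) (W : R -> C) (x : R) :
  ex_derive (K := C_AbsRing) (V := C_NormedModule) alpha (W x) ->
  ccontinuous W x -> ccontinuous (fun y => alpha (W y)) x.
Proof.
move=> /(ex_derive_continuous (K := C_AbsRing) (V := C_NormedModule)) ca cW.
apply/(filterlim_C (FF := filter_filter)).
apply: (filterlim_comp _ _ _ W alpha _ _ _ _ ca).
move=> P /locally_C; exact: (proj2 (filterlim_C (FF := filter_filter) W (W x)) cW).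
Qed.

(** At [x], with P(alpha(W(x)) + z) = W(x) + z (p1 + z Q(z)), the function
    z = alpha(W) - alpha(W(x)) satisfies z = (W - W(x)) / p1 - z z Q(z) / p1. *)
Lemma root_branch_analytic (N : nat) (c : nat -> C) (Omega : C -> Prop)
    (alpha : C -> C) (J : R -> Prop) (W : R -> C) : open_interval J ->
  root_branch N c Omega alpha -> analytic_on J W ->
  (forall x, J x -> Omega (W x)) -> analytic_on J (fun x => alpha (W x)).
Proof.
move=> hJ hb /analytic_onP hW hO; apply/analytic_onP => x Jx.
have [oO dO eO] := hb.
have [p1 [ps hP]] := Peval_taylor N c (alpha (W x)).
have p0 := root_branch_simple hb (hO x Jx) hP.
pose z y := (alpha (W y) - alpha (W x))%C.
suff hz : analytic_at z x.
  apply: analytic_at_ext_loc (analytic_at_plus hz (analytic_at_const (alpha (W x)) x)).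
  by apply: filter_forall => y; rewrite /z; ring.
apply: (implicit_analytic_at (q0 := fun y => ((W y - W x) * / p1)%C) (q1 := fun _ => RtoC 0)
  (qs := [seq (fun _ => (- / p1 * p)%C) | p <- ps])).
- apply: List.Forall_cons.
    apply: analytic_at_mult; last exact: analytic_at_const.
    by apply: analytic_at_minus; [exact: hW | exact: analytic_at_const].
  apply: List.Forall_cons; first exact: analytic_at_const.
  elim: ps {hP} => [|p ps IH]; first exact: List.Forall_nil.
  by apply: List.Forall_cons => //; exact: analytic_at_const.
- by ring.
- by [].
- by rewrite /z; ring.
- apply: ccontinuous_plus; last exact: ccontinuous_const.
  by apply: ccontinuous_comp; [apply: dO; exact: hO | apply: analytic_at_ccontinuous;
    exact: hW].
- apply: filter_imp (open_interval_open hJ Jx) => y Jy.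
  rewrite [nest _ _ _]/= nest_eval_list.
  have := eO _ (hO y Jy).
  have -> : alpha (W y) = (alpha (W x) + z y)%C by rewrite /z; ring.
  rewrite hP (eO _ (hO x Jx)) => E.
  by rewrite -E; field.
Qed.

(** alpha(W) is a root of P(u) - W, a polynomial of degree [N > 0] over every
    field that contains [W]. *)
Lemma root_branch_elementary (N : nat) (c : nat -> C) (Omega : C -> Prop)
    (alpha : C -> C) (J : R -> Prop) (W : R -> C) : open_interval J ->
  (0 < N)%N -> c N <> RtoC 0 ->
  root_branch N c Omega alpha -> elementary_on J W ->
  (forall x, J x -> Omega (W x)) -> elementary_on J (fun x => alpha (W x)).
Proof.
move=> hJ hN hc hb hW hO.
have aW := elementary_analytic hJ hW; have [_ [K eK KW]] := hW.
have ag := root_branch_analytic hJ hb aW hO.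
have hK := elementary_is_field hJ eK.
apply/elementary_onE => //; split=> //.
exists (adjoin J K (fun x => alpha (W x))); last exact: adjoin_gen.
apply: elementary_field_adjoin => //; first exact: quotient_analytic.
right; right.
pose a i : R -> C := if i == 0%N then (fun x => (c 0%N - W x)%C)
  else if (i <= N)%N then (fun _ => c i) else (fun _ => RtoC 0).
have Kc d : K (fun _ => d) by exact: (field_const hK).
apply: (vanishing_algebraic hJ hK (quotient_analytic hJ ag) (n := N) (a := a)); split;
  first split.
- move=> i; rewrite /a; case: ifP => _; last by case: ifP.
  by apply: (field_plus hK) => //; exact: (field_opp hK).
- rewrite /a eqn0Ngt hN leqnn /=; apply: generically_neq0_not_same => //.
  exact: generically_all.
- move=> i hi; rewrite /a eqn0Ngt (leq_trans _ hi) // leqNgt hi /=.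
  exact: generically_all.
- apply: generically_all => // x Jx.
  have E n : (n <= N)%N -> poly_eval n a (fun x =>
    alpha (W x)) x = (Peval n c (alpha (W x)) - W x)%C.
    elim: n => [|n IH] hn; rewrite /poly_eval /Peval ?csum_S ?csum_0.
      by rewrite /a /=; ring.
    rewrite -/(poly_eval n a (fun x => alpha (W x)) x) IH ?(ltnW hn) //.
    by rewrite /a /= hn /Peval; ring.
  by case: hb => _ _ eO; rewrite E // eO; [rewrite /zero_fun; ring | exact: hO].
Qed.

(** * Elementary primitives from the two criteria *)

Lemma csum1_0 (F : nat -> C) : (sum_n_m F 1 0 : C) = RtoC 0.
Proof. by apply: sum_n_m_zero; apply/ltP. Qed.

Lemma csum1_S (F : nat -> C) (n : nat) : (sum_n_m F 1 n.+1 : C) = (sum_n_m F 1 n + F n.+1)%C.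
Proof. by apply: sum_n_Sm; apply/leP. Qed.

Lemma csum1_ext (F G : nat -> C) (n : nat) :
  (forall i, (1 <= i <= n)%N -> F i = G i) -> (sum_n_m F 1 n : C) = sum_n_m G 1 n.
Proof.
elim: n => [|n IH] h; first by rewrite !csum1_0.
rewrite !csum1_S IH ?h ?leqnn // => i /andP [h1 h2].
by apply: h; rewrite h1 leqW.
Qed.

Lemma csum1_scal (c : C) (F : nat -> C) (n : nat) :
  (c * sum_n_m F 1 n)%C = sum_n_m (fun i => (c * F i)%C) 1 n.
Proof.
elim: n => [|n IH]; first by rewrite !csum1_0; ring.
by rewrite !csum1_S -IH; ring.
Qed.

Lemma csum1_zero (n : nat) : (sum_n_m (fun _ => RtoC 0) 1 n : C) = RtoC 0.
Proof. by elim: n => [|n IH]; rewrite ?csum1_0 // csum1_S IH; ring. Qed.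

Lemma cderive_csum1 (F : nat -> R -> C) (l : nat -> C) (n : nat) (x : R) :
  (forall i, (1 <= i <= n)%N -> is_cderive (F i) x (l i)) ->
  is_cderive (fun y => sum_n_m (fun i => F i y) 1 n : C) x (sum_n_m l 1 n).
Proof.
elim: n => [|n IH] h.
  rewrite csum1_0; apply: cderive_ext_loc (cderive_const (RtoC 0) x).
  by apply: filter_forall => y; rewrite csum1_0.
rewrite csum1_S; apply: (cderive_ext_loc (F :=
  fun y => (sum_n_m (fun i => F i y) 1 n + F n.+1 y)%C)).
  by apply: filter_forall => y; rewrite csum1_S.
apply: cderive_plus; last by apply: h; rewrite leqnn.
by apply: IH => i /andP [h1 h2]; apply: h; rewrite h1 leqW.
Qed.

Lemma elementary_csum1 (J : R -> Prop) (F : nat -> R -> C) (n : nat) : open_interval J ->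
  (forall i, (1 <= i <= n)%N -> elementary_on J (F i)) ->
  elementary_on J (fun y => sum_n_m (fun i => F i y) 1 n : C).
Proof.
move=> hJ; elim: n => [|n IH] h.
  apply: (elementary_ext hJ _ (elementary_const hJ (RtoC 0))) => y _.
  by rewrite csum1_0.
apply: (elementary_ext hJ (F := fun y => (sum_n_m (fun i => F i y) 1 n + F n.+1 y)%C)).
  by move=> y _; rewrite csum1_S.
apply: elementary_plus => //; last by apply: h; rewrite leqnn.
by apply: IH => i /andP [h1 h2]; apply: h; rewrite h1 leqW.
Qed.

Definition elementary_primitive (J : R -> Prop) (phi : R -> C) : Prop :=
  exists2 H, elementary_on J H & forall x, J x -> is_cderive H x (phi x).

Lemma liouville_primitive (J : R -> Prop) (x0 : R) (fs : nat -> R -> C) (j : nat) :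
  open_interval J -> J x0 -> Liouville_criterion J x0 fs j ->
  elementary_primitive J (fun x => gij x0 fs 2 j x / fs 1%N x)%C.
Proof.
move=> hJ J0 [n [c [h [sigma [hh hs e]]]]].
pose L i := CInt (fun x => (Dx (h i) x / h i x)%C) x0.
have dL i : (1 <= i <= n)%N -> forall x, J x -> is_cderive (L i) x (Dx (h i) x / h i x)%C.
  move=> /hh [eh nh] x Jx.
  apply: (CInt_cderive hJ (f := fun x => (Dx (h i) x / h i x)%C)) => // y Jy.
  have /analytic_onP ah := elementary_analytic hJ eh.
  apply: analytic_at_ccontinuous; apply: analytic_at_mult; first by apply: analytic_at_Dx;
    exact: ah.
  by apply: analytic_at_inv; [exact: ah | exact: nh].
exists (fun x => (sum_n_m (fun i => (c i * L i x)%C) 1 n + sigma x)%C).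
  apply: elementary_plus => //; apply: (elementary_csum1 (F :=
    fun i x => (c i * L i x)%C)) => // i hi.
  apply: elementary_mult => //; first exact: elementary_const.
  by have [eh nh] := hh i hi; apply: (elementary_log hJ eh nh); exact: dL.
move=> x Jx; rewrite e //; apply: cderive_plus; last first.
  exact: (smooth_cderive 0 (proj1 hs) Jx).
apply: (cderive_csum1 (F := fun i x => (c i * L i x)%C)) => i hi.
by apply: cderive_scal; exact: dL.
Qed.

(** Repeated integration by parts: if S' = g^(p) nu, then g^(p-1) nu - S is a
    primitive of g^(p-1) nu', and so on down to a primitive of g nu^(p). *)
Lemma parts_primitive (J : R -> Prop) (g : R -> C) (p : nat) (nu S : R ->
  C) : open_interval J ->
  elementary_on J g -> elementary_on J nu -> elementary_on J S ->
  (forall x, J x -> Dx S x = (Dn p g x * nu x)%C) ->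
  elementary_primitive J (fun x => g x * Dn p nu x)%C.
Proof.
move=> hJ hg; have hD q : elementary_on J (Dn q g).
  by elim: q => [|q IH] //; exact: elementary_on_Dx.
elim: p nu S => [|p IH] nu S hnu hS e.
  exists S => // x Jx; rewrite -e //; exact: (smooth_cderive 0 (proj1 hS) Jx).
have -> : (fun x => (g x * Dn p.+1 nu x)%C) = (fun x => (g x * Dn p (Dx nu) x)%C).
  by apply: functional_extensionality => x; rewrite /Dn iterSr.
apply: (IH (Dx nu) (fun x => (Dn p g x * nu x - S x)%C)).
- exact: elementary_on_Dx.
- by apply: elementary_minus => //; exact: elementary_mult.
- move=> x Jx; apply: cderive_Dx.
  have h1 := smooth_cderive p (proj1 hg) Jx; have h2 := smooth_cderive 0 (proj1 hnu) Jx.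
  have h3 := smooth_cderive 0 (proj1 hS) Jx.
  apply: cderive_eqr (cderive_plus (cderive_mult h1 h2) (cderive_opp h3)).
  by rewrite /= e // -/(Dn p g); rewrite /Dn /=; ring.
Qed.

(** * The solutions [V_j] *)

Section Solutions.

Variables (k : nat) (I : R -> Prop) (x0 : R) (fs : nat -> R -> C).
Hypotheses (hI : open_interval I) (I0 : I x0).
Hypothesis hfs : forall j, (1 <= j <= k.-1)%N ->
  smooth_on I (fs j) /\ forall x, I x -> fs j x <> RtoC 0.

Lemma gijE (i j : nat) : (1 <= i <= j)%N ->
  gij x0 fs i j = CInt (fun s => (gij x0 fs i.+1 j s / fs i s)%C) x0.
Proof.
case/andP=> i1 ij; apply: functional_extensionality => x; rewrite /gij ij.
case: (ltngtP i j) ij => // [lt _|-> _]; last first.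
  rewrite subnn /= /Rf; congr CInt.
  by apply: functional_extensionality => s; rewrite /Cdiv Cmult_1_l.
have -> : (j - i = (j - i.+1).+1)%N by lia.
rewrite /=; congr CInt; apply: functional_extensionality => s.
by congr (_ / fs _ s)%C; lia.
Qed.

Lemma gij_1 (i j : nat) (x : R) : (j < i)%N -> gij x0 fs i j x = RtoC 1.
Proof. by move=> lt; rewrite /gij leqNgt lt. Qed.

Lemma ccontinuous_integrand (i j : nat) : (1 <= i <= k.-1)%N ->
  (forall x, I x -> ccontinuous (gij x0 fs i.+1 j) x) ->
  forall x, I x -> ccontinuous (fun s => (gij x0 fs i.+1 j s / fs i s)%C) x.
Proof.
move=> hi h x Ix; have [sf nf] := hfs hi.
apply: ccontinuous_mult; first exact: h.
by apply: ccontinuous_inv; [exact: smooth_ccontinuous sf Ix | exact: nf].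
Qed.

Lemma gij_ccontinuous (i j : nat) : (1 <= i)%N -> (j <= k.-1)%N ->
  forall x, I x -> ccontinuous (gij x0 fs i j) x.
Proof.
move=> i1 jk; have [d hd] : exists d, (j < i + d)%N by exists j.+1; lia.
elim: d i i1 hd => [|d IH] i i1 hd x Ix.
  have -> : gij x0 fs i j = fun _ => RtoC 1.
    by apply: functional_extensionality => y; rewrite gij_1 //; lia.
  exact: ccontinuous_const.
case: (ltnP j i) => [lt|le].
  have -> : gij x0 fs i j = fun _ => RtoC 1.
    by apply: functional_extensionality => y; rewrite gij_1.
  exact: ccontinuous_const.
rewrite gijE ?i1 //; apply: cderive_ccontinuous.
apply: (CInt_cderive hI (f := fun s => (gij x0 fs i.+1 j s / fs i s)%C)) => //.
apply: ccontinuous_integrand; first by lia.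
by apply: IH; lia.
Qed.

Lemma gij_cderive (i j : nat) (x : R) : (1 <= i <= j)%N -> (j <= k.-1)%N -> I x ->
  is_cderive (gij x0 fs i j) x (gij x0 fs i.+1 j x / fs i x)%C.
Proof.
move=> /andP [i1 ij] jk Ix; rewrite gijE ?i1 //.
apply: (CInt_cderive hI (f := fun s => (gij x0 fs i.+1 j s / fs i s)%C)) => //.
by apply: ccontinuous_integrand; [lia | apply: gij_ccontinuous].
Qed.

(** The function [V_j] continues the pattern of the g_(i:j) down to i = 1. *)
Lemma VjE (f : R -> C) (j : nat) (x t : R) : (1 <= j)%N ->
  Vj x0 fs f j x t = (f t * gij x0 fs 1 j x)%C.
Proof.
move=> j1; rewrite gijE //; case: j j1 => [//|[|j]] _ //=.
rewrite /Rf; congr (_ * CInt _ _ _)%C; apply: functional_extensionality => s.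
by rewrite gij_1 // /Cdiv Cmult_1_l.
Qed.

(** Each derivation undoes one integration and the next factor f_i cancels the
    denominator, until g_(j+1:j) = 1 is reached, whose derivative is 0. *)
Lemma iterated_operator_gij (n : nat) (B : nat -> C) (j : nat -> nat) (m : nat) (x : R) :
  (forall s, (1 <= s <= n)%N -> (1 <= j s <= k.-1)%N) -> (m <= k.-1)%N -> I x ->
  iterated_operator fs m (fun y => sum_n_m (fun s => (B s * gij x0 fs 1 (j s) y)%C) 1 n) x
  = sum_n_m (fun s => (B s * (if (m < j s)%N
      then gij x0 fs m.+2 (j s) x / fs m.+1 x else RtoC 0))%C) 1 n.
Proof.
move=> hj; elim: m x => [|m IH] x hm Ix.
  rewrite /iterated_operator; apply: cderive_Dx.
  apply: (cderive_csum1 (F := fun s y => (B s * gij x0 fs 1 (j s) y)%C)) => s hs.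
  have /andP [j1 jk] := hj s hs; rewrite j1; apply: cderive_scal.
  by apply: gij_cderive => //; rewrite j1.
have e : locally x (fun y => (fs m.+1 y * iterated_operator fs m
      (fun y => sum_n_m (fun s => (B s * gij x0 fs 1 (j s) y)%C) 1 n) y)%C
    = sum_n_m (fun s => (B s * (if (m < j s)%N then gij x0 fs m.+2
      (j s) y else RtoC 0))%C) 1 n).
  apply: filter_imp (open_interval_open hI Ix) => y Iy; rewrite IH //; last exact: ltnW.
  rewrite csum1_scal; apply: csum1_ext => s hs.
  have [_ nf] := hfs (j := m.+1) hm; have := nf y Iy => n0.
  by case: ifP => _; [field | ring].
rewrite [LHS]/= (Dx_ext_loc e); apply: cderive_Dx.
apply: (cderive_csum1 (F := fun s y =>
  (B s * (if (m < j s)%N then gij x0 fs m.+2 (j s) y else RtoC 0))%C)).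
move=> s hs; apply: cderive_scal; have /andP [j1 jk] := hj s hs.
case: (ltngtP m.+1 (j s)) => [lt|gt|eq].
- exact: gij_cderive.
- exact: cderive_const.
- have -> : (fun y => gij x0 fs m.+2 (j s) y) = (fun _ => RtoC 1).
    by apply: functional_extensionality => y; rewrite gij_1 //; lia.
  exact: cderive_const.
Qed.

Lemma iterated_operator_ext (J : R -> Prop) (m : nat) (w w' : R -> C) : open_interval J ->
  (forall x, J x -> w x = w' x) ->
  forall x, J x -> iterated_operator fs m w x = iterated_operator fs m w' x.
Proof.
move=> hJ e; elim: m => [|m IH] x Jx /=; apply: Dx_ext_loc;
apply: filter_imp (open_interval_open hJ Jx) => y Jy; first exact: e.
by rewrite IH.
Qed.

Lemma elementary_gij (j : nat) : (1 <= j <= k.-1)%N ->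
  elementary_primitive I (fun x => (gij x0 fs 2 j x / fs 1%N x)%C) ->
  elementary_on I (gij x0 fs 1 j).
Proof.
move=> /andP [j1 jk] [H eH dH].
apply: (elementary_ext hI (F := fun x => (H x - H x0)%C)); last first.
  by apply: elementary_minus => //; exact: elementary_const.
move=> x Ix; rewrite gijE //; symmetry.
apply: (CInt_unique hI (f := fun s => (gij x0 fs 2 j s / fs 1%N s)%C)) => //.
by apply: ccontinuous_integrand; [lia | apply: gij_ccontinuous].
Qed.

(** The common part of both assertions, which differ only in the reason why [W]
    is elementary. *)
Lemma branch_solution (N : nat) (c : nat -> C) (Omega : C -> Prop) (alpha : C -> C)
    (J : R -> Prop) (n : nat) (B : nat -> C) (j : nat -> nat) (W : R -> C) :
  (0 < N)%N -> c N <> RtoC 0 -> root_branch N c Omega alpha ->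
  open_interval J -> (forall x, J x -> I x) ->
  (forall s, (1 <= s <= n)%N -> (1 <= j s <= k.-1)%N) ->
  (forall x, W x = sum_n_m (fun s => (B s * gij x0 fs 1 (j s) x)%C) 1 n) ->
  elementary_on I W -> (forall x, J x -> Omega (W x)) ->
  elementary_on J (fun x => alpha (W x)) /\ is_solution k fs N c J (fun x => alpha (W x)).
Proof.
move=> hN hc hb hJ sub hj eW hW hO.
have hu := root_branch_elementary hJ hN hc hb (elementary_restrict hI hJ sub hW) hO.
split=> //; split; first by case: hu.
move=> x Jx; have [_ _ eO] := hb.
have E y : J y -> Peval N c (alpha (W y))
    = sum_n_m (fun s => (B s * gij x0 fs 1 (j s) y)%C) 1 n.
  by move=> Jy; rewrite -eW eO //; exact: hO.
rewrite (iterated_operator_ext _ hJ E Jx) iterated_operator_gij //; last exact: sub.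
rewrite -[RHS](csum1_zero n); apply: csum1_ext => s /hj /andP [_ jk].
by rewrite ltnNge jk Cmult_0_r.
Qed.

End Solutions.

Theorem proposition5p13
  (k : nat) (hk : (2 <= k)%N)
  (a b : Rbar) (x0 : R) (hx0 : ointerval a b x0)
  (fs : nat -> R -> C)
  (hfs : forall j, (1 <= j <= k.-1)%N ->
     smooth_on (ointerval a b) (fs j) /\
     forall x, ointerval a b x -> fs j x <> RtoC 0)
  (N : nat) (hN : (1 < N)%N)
  (c : nat -> C) (hc : c N <> RtoC 0)
  (hrad : solvable_by_radicals (P_minus_d N c))
  (f : R -> C) :
  (forall (k'' : nat) (j : nat -> nat),
     (k'' <= k.-1)%N ->
     (forall s, (1 <= s <= k'')%N -> (1 <= j s <= k.-1)%N) ->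
     (forall s s', (1 <= s <= k'')%N -> (1 <= s' <= k'')%N ->
        j s = j s' -> s = s') ->
     (forall s, (1 <= s <= k'')%N ->
        Liouville_criterion (ointerval a b) x0 fs (j s) \/
        (parts_criterion (ointerval a b) x0 fs (j s) /\
         elementary_on (ointerval a b) (gij x0 fs 2 (j s)))) ->
     forall (A : nat -> C) (Omega : C -> Prop) (alpha : C -> C),
       root_branch N c Omega alpha ->
       forall (t : R) (a' b' : Rbar),
         Rbar_lt a' b' ->
         (forall x, ointerval a' b' x -> ointerval a b x) ->
         let W := fun x : R =>
           sum_n_m (fun s => Cmult (A (j s)) (Vj x0 fs f (j s) x t)) 1 k'' in
         (forall x, ointerval a' b' x -> Omega (W x)) ->
         elementary_on (ointerval a' b') (fun x => alpha (W x)) /\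
         is_solution k fs N c (ointerval a' b') (fun x => alpha (W x)))
  /\
  ((forall t : R, elementary_on (ointerval a b) (fun x => Vj x0 fs f 1 x t)) ->
   forall (Omega : C -> Prop) (alpha : C -> C),
     root_branch N c Omega alpha ->
     forall (t : R) (a' b' : Rbar),
       Rbar_lt a' b' ->
       (forall x, ointerval a' b' x -> ointerval a b x) ->
       (forall x, ointerval a' b' x -> Omega (Vj x0 fs f 1 x t)) ->
       elementary_on (ointerval a' b') (fun x => alpha (Vj x0 fs f 1 x t)) /\
       is_solution k fs N c (ointerval a' b')
         (fun x => alpha (Vj x0 fs f 1 x t))).
Proof.
have hI : open_interval (ointerval a b).
  apply: ointerval_open_interval; case: hx0 => h1 h2; exact: Rbar_lt_trans h1 h2.
have hN0 : (0 < N)%N by exact: ltnW.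
split.
- move=> k'' j _ hj _ hcrit A Omega alpha hb t a' b' hab sub W hO.
  have eW x : W x = sum_n_m (fun s => (A (j s) * f t * gij x0 fs 1 (j s) x)%C) 1 k''.
    apply: csum1_ext => s /hj /andP [j1 _].
    by rewrite VjE // Cmult_assoc.
  apply: (branch_solution hI hx0 hfs hN0 hc hb (ointerval_open_interval hab) sub hj eW) => //.
  have -> : W = fun x => sum_n_m (fun s => (A (j s) * f t * gij x0 fs 1 (j s) x)%C) 1 k''.
    exact: functional_extensionality.
  apply: (elementary_csum1 (F := fun s x => (A (j s) * f t * gij x0 fs 1 (j s) x)%C)) =>
    // s hs.
  apply: elementary_mult => //; first exact: elementary_const.
  apply: (elementary_gij hI hx0 hfs (hj s hs)).
  case: (hcrit s hs) => [|[[nu [S [p [enu eS _ e1 e2]]]] eg]]; first exact: liouville_primitive.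
  have [H eH dH] := parts_primitive hI eg enu eS e2.
  by exists H => // x Ix; rewrite /Cdiv -e1 //; exact: dH.
- move=> eV Omega alpha hb t a' b' hab sub hO.
  have eW x : Vj x0 fs f 1 x t = sum_n_m (fun s => (f t * gij x0 fs 1 1 x)%C) 1 1.
    by rewrite VjE // csum1_S csum1_0 Cplus_0_l.
  apply: (branch_solution hI hx0 hfs hN0 hc hb (ointerval_open_interval hab) sub
    (j := fun _ => 1%N) _ eW) => // s _; lia.
Qed.
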